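(* Let $\mathcal{H}$ be a hypertree with tree-decomposition $(\mathcal{T},\chi)$, and consider the quadratic program $$\min_{x}\ \sum_{e\in E[\mathcal{H}]}\Big(\tfrac12 S_e^{T}Q_eS_e-b_e^{T}S_e\Big)\quad\text{subject to}\quad G_eS_e=h_e\ \ \forall e\in E[\mathcal{H}],$$ assumed to have a bounded solution and full-rank constraints. Then the KKT linear system $$\begin{bmatrix}Q & G^{T}\\ G & 0\end{bmatrix}\begin{bmatrix}x\\ \lambda\end{bmatrix}=\begin{bmatrix}b\\ h\end{bmatrix}$$ can be solved in time $\tilde O(\operatorname{tw}(\mathcal{H})^3)$, given the minimal tree-decomposition, via the Graphical QP message-passing algorithm described in the context.
   Context: $\mathcal{H}$ is a finite hypergraph with vertex set $V[\mathcal{H}]$ and hyperedge set $E[\mathcal{H}]$. One real variable is attached to each vertex; $x\in\mathbb{R}^{|V[\mathcal{H}]|}$ collects them and $S_e$ is the subvector indexed by the vertices of $e$. For each $e$, $Q_e$ is a symmetric $|e|\times|e|$ real matrix, $b_e\in\mathbb{R}^{|e|}$, $G_e$ is a real matrix with $|e|$ columns and $h_e$ a real vector of matching length. $Q$ and $b$ are assembled by adding the $Q_e$ and $b_e$ vertex label-wise (padded by zeros to $V[\mathcal{H}]$); $G$ and $h$ are obtained by stacking the $G_e$ (columns padded by zeros) and the $h_e$. Thus $b\in\mathbb{R}^{|V[\mathcal{H}]|}$ and $\lambda,h\in\mathbb{R}^{M}$, where $M$ is the total number of constraint rows. A tree-decomposition of $\mathcal{H}$ is a tree $\mathcal{T}$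 with a map $\chi:V[\mathcal{T}]\to2^{V[\mathcal{H}]}$ such that (i) $\bigcup_{i\in V[\mathcal{T}]}\chi(i)=V[\mathcal{H}]$; (ii) for every $e\in E[\mathcal{H}]$ there is $i\in V[\mathcal{T}]$ with $e\subset\chi(i)$; (iii) for every $u\in V[\mathcal{H}]$ the subgraph of $\mathcal{T}$ induced on $\{i:u\in\chi(i)\}$ is a non-empty subtree. Its tree-width is $\max_{i}|\chi(i)|-1$; $\operatorname{tw}(\mathcal{H})$ is the minimal tree-width attained by any tree-decomposition of $\mathcal{H}$, and a minimal tree-decomposition is one attaining it. A hypertree is a hypergraph whose hyperedges are the bags $\chi(i)$, $i\in V[\mathcal{T}]$, of its tree-decomposition; for $l\in V[\mathcal{T}]$ write $Q_l,b_l,G_l,h_l$ for the data of the hyperedge $\chi(l)$. The Graphical QP algorithm. Gather stage: messages are passed from the leaves of $\mathcal{T}$ towards a root by the recursive function GatherMessage$(l,p,\mathcal{T})$, where $p$ is the parent of $l$ ($\chi(p)$ being read as empty at the root). It does the following. (a) Set $(\tilde Q,\tilde b,\tilde G,\tilde h)=(Q_l,b_l,G_l,h_l)$. (b) For each neighbour $c\neq p$ of $l$ in $\mathcal{T}$, obtain $(Q_{c\to l},G_{c\to l},b_{c\to l},h_{c\to l})$ from GatherMessage$(c,l,\mathcal{T})$, add $(Q_{c\to l},b_{c\to l})$ vertex label-wise to $(\tilde Q,\tilde b)$, and append the rows $G_{c\to l}$ to $\tilde G$ and $h_{c\to l}$ to $\tilde h$. (c) Return the result of Factorize, as follows. Let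 $\iota=\chi(l)\setminus\chi(p)$ (vertices interior to $l$), $\xi=\chi(l)\cap\chi(p)$ (boundary vertices, common to $l$ and $p$), and $r=\operatorname{rank}(\tilde Q_{\iota,\iota})$. With subscript $:r$ denoting the first $r$ constraint rows and $r:$ the remaining ones, form the block system $Jz=g$: $$\begin{bmatrix}\tilde Q_{\xi\xi}&\tilde Q_{\iota\xi}^{T}&\tilde G_{:r,\xi}^{T}&\tilde G_{r:,\xi}^{T}\\ \tilde Q_{\iota\xi}&\tilde Q_{\iota\iota}&\tilde G_{:r,\iota}^{T}&\tilde G_{r:,\iota}^{T}\\ \tilde G_{:r,\xi}&\tilde G_{:r,\iota}&0&0\\ \tilde G_{r:,\xi}&\tilde G_{r:,\iota}&0&0\end{bmatrix}\begin{bmatrix}S_\xi\\S_\iota\\\lambda_{:r}\\\lambda_{r:}\end{bmatrix}=\begin{bmatrix}\tilde b_\xi\\\tilde b_\iota\\\tilde h_{:r}\\\tilde h_{r:}\end{bmatrix}.$$ The matrices here are not necessarily positive definite, but are taken to be invertible (in particular the pivot block used below). The message from $l$ to $p$ is the Gaussian belief-propagation (partial LU) message from the block pivots $P=\{2,3\}$ to the blocks $R=\{1,4\}$, i.e. $J_{RR}-J_{RP}J_{PP}^{-1}J_{PR}$ and $g_R-J_{RP}J_{PP}^{-1}g_P$, whose parts give $Q_{l\to p},G_{l\to p},b_{l\to p},h_{l\to p}$. The remaining stage is back-substitution from the root to the leaves: the eliminated variables are recovered by $z_P=J_{PP}^{-1}(g_P-J_{PR}z_R)$. The notation $\tilde O(\cdot)$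 hides factors linear in $|V[\mathcal{H}]|$ and $|E[\mathcal{H}]|$.
   Formalization: Added assumption: each message to a parent has zero constraint-constraint block in its Schur complement (otherwise the algorithm can return a wrong answer); the bound uses max(1,tw) to cover tw = 0, and hyperedges are indexed one per bag, so repeated bags carry separate data. *)

(* Defs.v *)
From HB Require Import structures.
From mathcomp Require Import all_boot all_order all_algebra.

Set Implicit Arguments.
Unset Strict Implicit.
Unset Printing Implicit Defensive.

Import Order.TTheory GRing.Theory Num.Theory.
Local Open Scope ring_scope.

(** * Trees, tree-decompositions, tree-width

    Vertices are ['I_n]; the hyperedges are a family [edge] indexed by ['I_q],
    so that n = |V| and q = |E|. *)

(* The subgraph of [adj] induced on [S] is a non-empty tree. A cycle visiting
   at most two vertices is a back-and-forth along one edge. *)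
Definition tree_on (N : finType) (adj : rel N) (S : {set N}) : Prop :=
  [/\ S != set0,
      {in S &, forall i j,
         connect [rel x y | [&& x \in S, y \in S & adj x y]] i j} &
      forall c : seq N, ucycle adj c -> {subset c <= S} -> (size c <= 2)%N].

Definition is_tree (N : finType) (adj : rel N) : Prop :=
  [/\ symmetric adj, irreflexive adj & tree_on adj [set: N]].

Definition tree_decomposition (n q : nat) (edge : 'I_q -> {set 'I_n})
    (N : finType) (adj : rel N) (chi : N -> {set 'I_n}) : Prop :=
  [/\ is_tree adj,
      \bigcup_i chi i = [set: 'I_n],
      forall e, exists i, edge e \subset chi i &
      forall u, tree_on adj [set i | u \in chi i]].

Definition width (n : nat) (N : finType) (chi : N -> {set 'I_n}) : nat :=
  (\max_i #|chi i|).-1.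

Definition is_treewidth (n q : nat) (edge : 'I_q -> {set 'I_n}) (w : nat) : Prop :=
  (exists (N : finType) (adj : rel N) (chi : N -> {set 'I_n}),
     tree_decomposition edge adj chi /\ width chi = w) /\
  (forall (N : finType) (adj : rel N) (chi : N -> {set 'I_n}),
     tree_decomposition edge adj chi -> (w <= width chi)%N).

(* The hyperedges are exactly the bags; [node_edge l] is the hyperedge chi(l). *)
Definition hypertree (n q : nat) (edge : 'I_q -> {set 'I_n})
    (N : finType) (adj : rel N) (chi : N -> {set 'I_n})
    (node_edge : N -> 'I_q) : Prop :=
  [/\ tree_decomposition edge adj chi, bijective node_edge &
      forall l, edge (node_edge l) = chi l].

(** * The quadratic program and its KKT system *)

Record qp_data (R : realFieldType) (n q : nat) (edge : 'I_q -> {set 'I_n}) := QPData {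
  nrows : 'I_q -> nat;
  Qe : forall e, 'M[R]_#|edge e|;
  be : forall e, 'cV[R]_#|edge e|;
  Ge : forall e, 'M[R]_(nrows e, #|edge e|);
  he : forall e, 'cV[R]_(nrows e)
}.

(* The rows of the identity labelled by [s]: left-multiplication by [sel s]
   extracts the entries labelled by [s], and [(sel s)^T] pads with zeros. *)
Definition sel (R : realFieldType) (n : nat) (s : {set 'I_n}) : 'M[R]_(#|s|, n) :=
  rowsub enum_val 1%:M.

Section KKT.
Variables (R : realFieldType) (n q : nat) (edge : 'I_q -> {set 'I_n}).
Variable D : qp_data R edge.

Definition padQ (e : 'I_q) : 'M[R]_n := (sel R (edge e))^T *m Qe D e *m sel R (edge e).
Definition padb (e : 'I_q) : 'cV[R]_n := (sel R (edge e))^T *m be D e.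
Definition padG (e : 'I_q) : 'M[R]_(nrows D e, n) := Ge D e *m sel R (edge e).

Definition total_rows : nat := \sum_(e < q) nrows D e.

Definition Qmx : 'M[R]_n := \sum_(e < q) padQ e.
Definition bvec : 'cV[R]_n := \sum_(e < q) padb e.
Definition Gmx : 'M[R]_(total_rows, n) := \mxcol_(e < q) padG e.
Definition hvec : 'cV[R]_total_rows := \mxcol_(e < q) he D e.

Definition KKTmx : 'M[R]_(n + total_rows) := block_mx Qmx Gmx^T Gmx 0.

Definition subvec (x : 'cV[R]_n) (e : 'I_q) : 'cV[R]_#|edge e| := rowsub enum_val x.

Definition objective (x : 'cV[R]_n) : R :=
  \sum_(e < q) (2^-1 * ((subvec x e)^T *m Qe D e *m subvec x e) 0 0
                - ((be D e)^T *m subvec x e) 0 0).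

Definition feasible (x : 'cV[R]_n) : Prop :=
  forall e, Ge D e *m subvec x e = he D e.

(* The minimum is attained (in particular it is finite). *)
Definition has_bounded_solution : Prop :=
  exists2 x, feasible x & forall y, feasible y -> objective x <= objective y.

Definition full_rank_constraints : Prop := row_free Gmx.

End KKT.

(** * Counted arithmetic

    A [timed] value carries the number of operations of R used to obtain it: one
    unit for each addition, subtraction, multiplication, inversion and test
    against zero. Moving entries around (extraction and padding of blocks,
    transposition, row exchanges) is not arithmetic and is free. *)

Definition timed (T : Type) : Type := (T * nat)%type.
Definition ret (T : Type) (x : T) : timed T := (x, 0%N).
Definition tick (T : Type) (k : nat) (x : T) : timed T := (x, k).
Definition bind (T U : Type) (m : timed T) (f : T -> timed U) : timed U :=
  ((f m.1).1, (m.2 + (f m.1).2)%N).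

Notation "'let!' x ':=' m 'in' k" := (bind m (fun x => k))
  (at level 200, x name, m at level 100, k at level 200,
   format "'[v' 'let!'  x  ':='  m  'in' '/' k ']'").

Section Counted.
Variable R : realFieldType.

Definition add_t m n (A B : 'M[R]_(m, n)) : timed 'M[R]_(m, n) :=
  tick (m * n) (A + B).
Definition sub_t m n (A B : 'M[R]_(m, n)) : timed 'M[R]_(m, n) :=
  tick (m * n) (A - B).
Definition scale_t m n (a : R) (A : 'M[R]_(m, n)) : timed 'M[R]_(m, n) :=
  tick (m * n) (a *: A).
(* Schoolbook product: n products and at most n additions for each entry. *)
Definition mul_t m n p (A : 'M[R]_(m, n)) (B : 'M[R]_(n, p)) : timed 'M[R]_(m, p) :=
  tick (m * p * (2 * n)) (A *m B).
Definition inv_t (a : R) : timed R := tick 1 a^-1.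

(* Rank by Gaussian elimination with full pivoting. *)
Fixpoint gauss_rank (m n : nat) : 'M[R]_(m, n) -> timed nat :=
  match m, n return 'M[R]_(m, n) -> timed nat with
  | m'.+1, n'.+1 => fun A : 'M[R]_(1 + m', 1 + n') =>
    let! p := tick (m'.+1 * n'.+1) [pick ij | A ij.1 ij.2 != 0] in
    if p is Some (i, j) then
      let A1 : 'M[R]_(1 + m', 1 + n') := xrow i 0 (xcol j 0 A) in
      let! a := inv_t (A i j) in
      let! v := scale_t a (dlsubmx A1) in
      let! vu := mul_t v (ursubmx A1) in
      let! A2 := sub_t (drsubmx A1) vu in
      let! r := gauss_rank A2 in
      ret r.+1
    else ret 0%N
  | _, _ => fun _ => ret 0%N
  end.

(* Solution of A X = B by Gaussian elimination with row pivoting and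
   back-substitution; the result is meaningless when A is singular. *)
Fixpoint gauss_solve (n k : nat) : 'M[R]_n -> 'M[R]_(n, k) -> timed 'M[R]_(n, k) :=
  match n return 'M[R]_n -> 'M[R]_(n, k) -> timed 'M[R]_(n, k) with
  | 0 => fun _ B => ret B
  | n'.+1 => fun (A : 'M[R]_(1 + n')) (B : 'M[R]_(1 + n', k)) =>
    let! p := tick n'.+1 [pick i | A i 0 != 0] in
    let i := odflt 0 p in
    let A1 : 'M[R]_(1 + n') := xrow i 0 A in
    let B1 : 'M[R]_(1 + n', k) := xrow i 0 B in
    let! a := inv_t (A1 0 0) in
    let! v := scale_t a (dlsubmx A1) in
    let! vu := mul_t v (ursubmx A1) in
    let! A2 := sub_t (drsubmx A1) vu in
    let! vb := mul_t v (usubmx B1) in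
    let! B2 := sub_t (dsubmx B1) vb in
    let! X2 := gauss_solve A2 B2 in
    let! uX := mul_t (ursubmx A1) X2 in
    let! y := sub_t (usubmx B1) uX in
    let! x := scale_t a y in
    ret (col_mx x X2)
  end.

Lemma gauss_rankE m n (A : 'M[R]_(m, n)) : (gauss_rank A).1 = \rank A.
Proof.
have -> : \rank A = (Gaussian_elimination A).2.
  by rewrite !unlock; case: m n A => [|m] [|n] A.
rewrite unlock; elim: m n A => [|m IH] [|n] //= A.
case: pickP => [[i j] _|_] //=.
by rewrite /bind /= IH; case: (Gaussian_elimination_ _) => [[? ?] ?].
Qed.

Lemma gauss_solveE n k (A : 'M[R]_n) (B : 'M[R]_(n, k)) :
  A \in unitmx -> (gauss_solve A B).1 = invmx A *m B.
Proof.
move=> uA; suff AX : A *m (gauss_solve A B).1 = B by rewrite -{2}AX mulKmx.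
elim: n A B uA => [|n IH] A B uA; first by apply/matrixP => -[].
rewrite [gauss_solve _ _]/=; set p := [pick i | _]; set i := odflt 0 p.
rewrite /bind /=; set A1 : 'M_(1 + n) := xrow i 0 A.
set B1 : 'M_(1 + n, k) := xrow i 0 B.
set a := (A1 0 0)^-1; set A2 := drsubmx A1 - _; set B2 := dsubmx B1 - _.
have uA1 : A1 \in unitmx by rewrite /A1 xrowE unitmx_mul uA unitmx_perm.
have a_neq0 : A1 0 0 != 0.
  rewrite /A1 mxE perm.tpermR /i /p; case: pickP => //= A0; exfalso.
  have : A *m delta_mx 0 0 = 0 :> 'M_(1 + n, 1).
    apply/matrixP => r c; rewrite !mxE (bigD1 0) //= (eqP (negbFE (A0 r))) mul0r add0r.
    by rewrite big1 // => t t0; rewrite !mxE (negPf t0) mulr0.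
  move/(congr1 (mulmx (invmx A))); rewrite mulKmx // mulmx0 => /matrixP/(_ 0 0).
  by rewrite !mxE => /eqP; rewrite oner_eq0.
have ulE : ulsubmx A1 = (A1 0 0)%:M.
  by apply/matrixP => r c; rewrite !ord1 [RHS]mxE eqxx mulr1n 2!mxE; congr (A1 _ _); apply: val_inj.
have vc : a *: dlsubmx A1 *m (A1 0 0)%:M = dlsubmx A1.
  by rewrite mul_mx_scalar scalerA mulrC /a mulVf // scale1r.
have uA2 : A2 \in unitmx.
  have A1E : A1 = block_mx 1%:M 0 (a *: dlsubmx A1) 1%:M
                   *m block_mx (A1 0 0)%:M (ursubmx A1) 0 A2.
    rewrite mulmx_block !mul1mx !mul0mx !addr0 vc /A2 addrC subrK -ulE.
    by rewrite submxK.
  move: uA1; rewrite {1}A1E unitmx_mul => /andP[_].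
  by rewrite unitmxE det_ublock unitrM => /andP[_]; rewrite -unitmxE.
have {}IH := IH A2 B2 uA2; set X2 := (gauss_solve A2 B2).1 in IH *.
have uP : (tperm_mx i 0 : 'M[R]_(1 + n)) \in unitmx by apply: unitmx_perm.
set x := _ *: _; suff AX1 : A1 *m col_mx x X2 = B1.
  by apply: (can_inj (mulKmx uP)); rewrite mulmxA -!xrowE.
rewrite -[A1 in LHS]submxK -[RHS]vsubmxK mul_block_col ulE; congr col_mx.
  by rewrite mul_scalar_mx scalerA /a mulfV // scale1r subrK.
have -> : dlsubmx A1 *m x = a *: dlsubmx A1 *m (usubmx B1 - ursubmx A1 *m X2).
  by rewrite -scalemxAr -scalemxAl.
have -> : drsubmx A1 = A2 + a *: dlsubmx A1 *m ursubmx A1 by rewrite /A2 subrK.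
by rewrite mulmxDl IH mulmxBr mulmxA addrCA subrK /B2 subrK.
Qed.

End Counted.

(** * The message-passing algorithm *)

(* A constraint row: its multiplier's index in lambda, its coefficients
   (padded by zeros) and its right-hand side. *)
Record crow (R : realFieldType) (n M : nat) := CRow {
  lab : 'I_M; coef : 'rV[R]_n; rhs : R
}.

(* The tuple (Q, b, G, h) of a node or of a message, labelled by vertices
   through zero padding; G and h are a list of rows. *)
Record local_qp (R : realFieldType) (n M : nat) := LocalQP {
  lQ : 'M[R]_n; lb : 'cV[R]_n; lrows : seq (crow R n M)
}.

Section Rows.
Variables (R : realFieldType) (n M : nat).
Implicit Type s : seq (crow R n M).

Definition row_labels s : 'I_(size s) -> 'I_M := fun i => lab (tnth (in_tuple s) i).
Definition row_coefs s : 'M[R]_(size s, n) := \matrix_i coef (tnth (in_tuple s) i).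
Definition row_rhs s : 'cV[R]_(size s) := \col_i rhs (tnth (in_tuple s) i).

End Rows.

(* Overwrites the entries of [x] at the positions [f] by those of [z]. *)
Definition assign (R : realFieldType) (k N : nat) (f : 'I_k -> 'I_N)
    (z : 'cV[R]_k) (x : 'cV[R]_N) : 'cV[R]_N :=
  \col_u (if [pick i | f i == u] is Some i then z i 0 else x u 0).

(* The data of one call of Factorize, once r = rank Q~_{iota,iota} is known. *)
Record front (R : realFieldType) (n M : nat) := Front {
  acc : local_qp R n M; iota_set : {set 'I_n}; xi_set : {set 'I_n}; fr_rank : nat
}.

(* The blocks of J z = g, grouped into the pivots P = (S_iota, lambda_{:r})
   and the rest R = (S_xi, lambda_{r:}). *)
Section Front.
Variables (R : realFieldType) (n M : nat) (F : front R n M).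

Local Notation i_ := (enum_val (A := mem (iota_set F))).
Local Notation x_ := (enum_val (A := mem (xi_set F))).

Definition elim_rows : seq (crow R n M) := take (fr_rank F) (lrows (acc F)).
Definition kept_rows : seq (crow R n M) := drop (fr_rank F) (lrows (acc F)).

Definition Pdim : nat := #|iota_set F| + size elim_rows.
Definition Rdim : nat := #|xi_set F| + size kept_rows.

Definition JPP : 'M[R]_Pdim :=
  block_mx (mxsub i_ i_ (lQ (acc F))) (colsub i_ (row_coefs elim_rows))^T
           (colsub i_ (row_coefs elim_rows)) 0.
Definition JPR : 'M[R]_(Pdim, Rdim) :=
  block_mx (mxsub i_ x_ (lQ (acc F))) (colsub i_ (row_coefs kept_rows))^T
           (colsub x_ (row_coefs elim_rows)) 0.
Definition JRP : 'M[R]_(Rdim, Pdim) :=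
  block_mx (mxsub i_ x_ (lQ (acc F)))^T (colsub x_ (row_coefs elim_rows))^T
           (colsub i_ (row_coefs kept_rows)) 0.
Definition JRR : 'M[R]_Rdim :=
  block_mx (mxsub x_ x_ (lQ (acc F))) (colsub x_ (row_coefs kept_rows))^T
           (colsub x_ (row_coefs kept_rows)) 0.
Definition gP : 'cV[R]_Pdim := col_mx (rowsub i_ (lb (acc F))) (row_rhs elim_rows).
Definition gR : 'cV[R]_Rdim := col_mx (rowsub x_ (lb (acc F))) (row_rhs kept_rows).

Definition Jmx : 'M[R]_(Rdim + Pdim) := block_mx JRR JRP JPR JPP.

End Front.

(* What Factorize leaves behind: the inverse pivot, kept for back-substitution,
   and the message J_RR - J_RP J_PP^-1 J_PR, g_R - J_RP J_PP^-1 g_P. *)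
Record step (R : realFieldType) (n M : nat) := Step {
  fr : front R n M;
  pivot_inv : 'M[R]_(Pdim fr);
  msgJ : 'M[R]_(Rdim fr);
  msgg : 'cV[R]_(Rdim fr)
}.

Section Algorithm.
Variables (R : realFieldType) (n M : nat).

Definition factorize (iota xi : {set 'I_n}) (a : local_qp R n M) : timed (step R n M) :=
  let! r := gauss_rank (mxsub (enum_val (A := mem iota)) (enum_val (A := mem iota)) (lQ a)) in
  let F := Front a iota xi r in
  let! K := gauss_solve (JPP F) 1%:M in
  let! W := mul_t (JRP F) K in
  let! WJ := mul_t W (JPR F) in
  let! S := sub_t (JRR F) WJ in
  let! Wg := mul_t W (gP F) in
  let! t := sub_t (gR F) Wg in
  ret (@Step R n M F K S t).

(* The message as data (Q, b, G, h): it omits the constraint-constraint block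
   of [msgJ]. *)
Definition message (s : step R n M) : local_qp R n M :=
  let E := sel R (xi_set (fr s)) in
  let G := dlsubmx (msgJ s) *m E in
  let h := dsubmx (msgg s) in
  LocalQP (E^T *m ulsubmx (msgJ s) *m E) (E^T *m usubmx (msgg s))
    [seq CRow (row_labels k) (row k G) (h k 0) | k <- enum 'I_(size (kept_rows (fr s)))].

(* Label-wise addition touches only the entries labelled by [xi]. *)
Definition absorb (a : local_qp R n M) (s : step R n M) : timed (local_qp R n M) :=
  let k := #|xi_set (fr s)| in
  tick (k * k + k)
    (LocalQP (lQ a + lQ (message s)) (lb a + lb (message s))
             (lrows a ++ lrows (message s))).

Variables (N : finType) (adj : rel N) (chi : N -> {set 'I_n}).
Variable local : N -> local_qp R n M.

Definition parent_bag (p : option N) : {set 'I_n} :=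
  if p is Some p' then chi p' else set0.

Definition children (l : N) (p : option N) : seq N :=
  [seq c <- enum N | adj l c && (Some c != p)].

(* The step of [l], together with those of its proper descendants, descendants
   first. [fuel] bounds the recursion depth; on a tree, #|N| is enough. *)
Fixpoint gather (fuel : nat) (l : N) (p : option N) : timed (step R n M * seq (step R n M)) :=
  let! a :=
    (if fuel is fuel'.+1 then
       foldl (fun st c =>
         let! s := st in
         let! m := gather fuel' c (Some l) in
         let! a' := absorb s.1 m.1 in
         ret (a', s.2 ++ rcons m.2 m.1))
       (ret (local l, [::])) (children l p)
     else ret (local l, [::])) in
  let! s := factorize (chi l :\: parent_bag p) (chi l :&: parent_bag p) a.1 in
  ret (s, a.2).

Definition read_R (F : front R n M) (z : 'cV[R]_n * 'cV[R]_M) : 'cV[R]_(Rdim F) :=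
  col_mx (rowsub (enum_val (A := mem (xi_set F))) z.1)
         (rowsub (@row_labels R n M (kept_rows F)) z.2).

Definition write_R (F : front R n M) (zR : 'cV[R]_(Rdim F))
    (z : 'cV[R]_n * 'cV[R]_M) : 'cV[R]_n * 'cV[R]_M :=
  (assign (enum_val (A := mem (xi_set F))) (usubmx zR) z.1,
   assign (@row_labels R n M (kept_rows F)) (dsubmx zR) z.2).

Definition write_P (F : front R n M) (zP : 'cV[R]_(Pdim F))
    (z : 'cV[R]_n * 'cV[R]_M) : 'cV[R]_n * 'cV[R]_M :=
  (assign (enum_val (A := mem (iota_set F))) (usubmx zP) z.1,
   assign (@row_labels R n M (elim_rows F)) (dsubmx zP) z.2).

Definition back_substitute (z : 'cV[R]_n * 'cV[R]_M) (s : step R n M) :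
    timed ('cV[R]_n * 'cV[R]_M) :=
  let! u := mul_t (JPR (fr s)) (read_R (fr s) z) in
  let! d := sub_t (gP (fr s)) u in
  let! zP := mul_t (pivot_inv s) d in
  ret (write_P zP z).

(* At the root there is no message to send: the remaining system, in the
   multipliers lambda_{r:} alone, is solved directly. *)
Definition message_passing (root : N) : timed ('cV[R]_n * 'cV[R]_M) :=
  let! m := gather #|N| root None in
  let! zR := gauss_solve (msgJ m.1) (msgg m.1) in
  foldl (fun st s => let! z := st in back_substitute z s)
    (ret (write_R zR (0, 0))) (m.1 :: rev m.2).

(* The algorithm's standing assumptions on the matrices it meets: the pivot
   blocks are invertible, the system J z = g left at the root is invertible,
   and every message sent to a parent has the form [Q G^T; G 0], i.e. it is
   determined by the (Q, G, b, h) that are passed on. *)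
Definition well_posed_run (root : N) : bool :=
  let m := (gather #|N| root None).1 in
  [&& all (fun s => JPP (fr s) \in unitmx) (m.1 :: m.2),
      Jmx (fr m.1) \in unitmx &
      all (fun s => drsubmx (msgJ s) == 0) m.2].

End Algorithm.

Section GraphicalQP.
Variables (R : realFieldType) (n q : nat) (edge : 'I_q -> {set 'I_n}).
Variable D : qp_data R edge.
Variables (N : finType) (adj : rel N) (chi : N -> {set 'I_n}) (node_edge : N -> 'I_q).

Definition edge_qp (e : 'I_q) : local_qp R n (total_rows D) :=
  LocalQP (padQ D e) (padb D e)
    [seq CRow (tagnat.Rank e k) (row k (padG D e)) (he D e k 0)
    | k <- enum 'I_(nrows D e)].

Definition graphical_qp (root : N) : timed ('cV[R]_n * 'cV[R]_(total_rows D)) :=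
  message_passing adj chi (fun l => edge_qp (node_edge l)) root.

Definition graphical_qp_well_posed (root : N) : Prop :=
  well_posed_run adj chi (fun l => edge_qp (node_edge l)) root.

End GraphicalQP.

(* Main.v *)
Require Import Defs.
From HB Require Import structures.
From mathcomp Require Import all_boot all_order all_algebra.
From mathcomp Require Import zify.

Set Implicit Arguments.
Unset Strict Implicit.
Unset Printing Implicit Defensive.

Import Order.TTheory GRing.Theory Num.Theory.
Local Open Scope ring_scope.

(** Solving the KKT system means making two residuals vanish at a point
    z = (x, lambda): the gradient Q x + G^T lambda - b of the Lagrangian and
    the defect G x - h of the constraints. The first is a sum over the nodes of
    the tree, the second is a list over them, and elimination conserves both:
    if z solves the pivot equations at a node, the data collected there and the
    message sent to the parent have the same gradient at z, and z satisfies the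
    collected rows as soon as it satisfies the rows of the message
    ([message_vres], [message_sat]). For the rows this uses that the message has
    no constraint-constraint block. By induction on the tree the data collected
    at the root stand for the whole program ([gather_represents]); the root
    solves them exactly, so both residuals vanish.

    It remains that the computed point solves the pivot equations of every
    node. Back-substitution solves them in turn, from the root down, and does
    not spoil them later ([back_solves]): by the running intersection property
    a vertex eliminated at a node occurs only in bags of the branch below that
    node, and the constraint rows of different branches are different
    ([gather_scheduled]).

    The work at a node is cubic in the number of unknowns of its front, that is
    of bag vertices and of collected rows. The number of rows is controlled
    from the root down. At the root the invertibility of J makes the collected
    rows independent ([Jmx_indep]); a dependence between the rows collected at
    a child would survive in its message, so independence descends
    ([message_indep]); and independent rows supported on a bag are at most as
    many as its vertices ([indep_size]). Summing over the q nodes, with bags of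
    at most tw + 1 vertices, gives the bound ([message_passing_cost]). *)

(** * Sequences *)

Section Sequences.

Variable T : Type.

(** For rewriting where simplification would also unfold the head. *)
Lemma all_consE (P : pred T) x (xs : seq T) : all P (x :: xs) = P x && all P xs.
Proof. by []. Qed.

Lemma pairwise_flatten (I : eqType) (r : rel T) (f : I -> seq T) (cs : seq I) : uniq cs ->
  {in cs, forall c, pairwise r (f c)} ->
  {in cs &, forall c1 c2, c1 != c2 -> allrel r (f c1) (f c2)} ->
  pairwise r (flatten [seq f c | c <- cs]).
Proof.
elim: cs => //= c cs IH /andP[c_notin uniq_cs] pw rel_f.
rewrite pairwise_cat pw ?mem_head //= IH // ?andbT; first last.
- by move=> c1 c2 c1_in c2_in; apply: rel_f; rewrite inE ?c1_in ?c2_in orbT.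
- by move=> c1 c1_in; apply: pw; rewrite inE c1_in orbT.
have {IH} := c_notin; elim: cs {uniq_cs c_notin pw} rel_f => [|c' cs IH] rel_f /=.
  by rewrite allrel0r.
rewrite inE negb_or => /andP[cc' c_notin]; rewrite allrel_catr IH ?rel_f ?andbT ?mem_head //.
  by rewrite !inE eqxx orbT.
move=> c1 c2; rewrite !inE => /orP[c1_in|c1_in] /orP[c2_in|c2_in];
  by apply: rel_f; rewrite !inE ?c1_in ?c2_in ?orbT.
Qed.

Lemma allrel_all (A B : pred T) (r : rel T) xs ys :
  all A xs -> all B ys -> (forall x y, A x -> B y -> r x y) -> allrel r xs ys.
Proof. by move=> Axs Bys AB; apply: sub_all Axs => x Ax; apply: sub_all Bys => y; apply: AB. Qed.

Lemma pairwise_rev (r : rel T) xs :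
  pairwise (fun x y => r y x) (rev xs) = pairwise r xs.
Proof. by elim: xs => //= x xs IH; rewrite rev_cons pairwise_rcons all_rev IH. Qed.

End Sequences.

(** * Branches of a tree *)

Section Branches.

Variables (N : finType) (adj : rel N).

Definition avoid (p : option N) : rel N :=
  [rel x y | [&& Some x != p, Some y != p & adj x y]].

(** For a neighbour [p'] of [l], [branch l (Some p')] is the subtree hanging
    from [l] on the side away from [p']; [branch l None] is the whole tree. *)
Definition branch (l : N) (p : option N) : {set N} :=
  [set x | connect (avoid p) l x].

Definition rooted_at (l : N) (p : option N) : bool :=
  if p is Some p' then adj l p' else true.

Hypothesis tree : is_tree adj.

Let adj_sym : symmetric adj. Proof. by case: tree. Qed.
Let adj_irr : irreflexive adj. Proof. by case: tree. Qed.

Lemma avoid_sym p : symmetric (avoid p).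
Proof. by move=> x y; rewrite /avoid /= adj_sym andbCA. Qed.

Lemma branch_refl l p : l \in branch l p.
Proof. by rewrite inE connect0. Qed.

Lemma branch_root l : branch l None = [set: N].
Proof.
apply/setP => x; rewrite !inE; case: tree => _ _ [_ /(_ l x) conn _].
by apply: connect_sub (conn (in_setT _) (in_setT _)) => a b /and3P[_ _ ab]; apply: connect1.
Qed.

Lemma branch_avoid l p x : Some l != p -> x \in branch l p -> Some x != p.
Proof.
move=> lp; rewrite inE => /connectP[s]; elim: s l lp => [|y s IH] l lp /=; first by move=> _ ->.
by case/andP=> /and3P[_ yp _]; apply: IH.
Qed.

Lemma rooted_neq l p : rooted_at l p -> Some l != p.
Proof.
case: p => [p|] //= lp; apply: contraTneq lp => -[<-].
by rewrite adj_irr.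
Qed.

Lemma mem_children l p c : (c \in children adj l p) = adj l c && (Some c != p).
Proof. by rewrite mem_filter mem_enum andbT. Qed.

Lemma uniq_children l p : uniq (children adj l p).
Proof. by rewrite filter_uniq // enum_uniq. Qed.

Lemma rooted_child l p c : c \in children adj l p -> rooted_at c (Some l).
Proof. by rewrite mem_children /= adj_sym => /andP[]. Qed.

(** Two neighbours of [l] joined by a path that misses [l] close up, through
    [l], to a cycle. *)
Lemma neighbour_branch l c1 c2 : adj l c1 -> adj l c2 ->
  c2 \in branch c1 (Some l) -> c1 = c2.
Proof.
move=> lc1 lc2; rewrite inE => /connectP[s0 path0 c2E].
have cl : Some c1 != Some l by apply: contraTneq lc1 => -[->]; rewrite adj_irr.
rewrite {c2}c2E in lc2 *; case/shortenP: path0 lc2 => -[|y s] // path_s uniq_s _ lc2.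
have miss_l x : x \in c1 :: y :: s -> l != x.
  have miss t a b : path (avoid (Some l)) a t -> Some a != Some l -> b \in a :: t -> l != b.
    elim: t a => [|a' t IH] a /=; first by rewrite inE eq_sym => _ la /eqP->.
    case/andP=> /and3P[_ la' _] path_t la; rewrite inE => /predU1P[->|]; last exact: IH.
    by rewrite eq_sym.
  exact: miss path_s cl.
have [_ _ [_ _ acyclic]] := tree; exfalso.
suff cyc: ucycle adj (l :: c1 :: y :: s) by have := acyclic _ cyc (fun _ _ => in_setT _).
have adj_path : path adj c1 (y :: s) by apply: sub_path path_s => a b /and3P[].
have l_notin : l \notin c1 :: y :: s by apply/negP => /miss_l; rewrite eqxx.
rewrite /ucycle cons_uniq uniq_s l_notin !andbT.
have -> : cycle adj (l :: c1 :: y :: s) = path adj l (rcons (c1 :: y :: s) l) by [].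
rewrite rcons_path; apply/andP; split; last by rewrite adj_sym.
by move: adj_path => /= ->; rewrite lc1.
Qed.

Lemma sub_branch l p c : rooted_at l p -> c \in children adj l p ->
  branch c (Some l) \subset branch l p.
Proof.
move=> lp; rewrite mem_children => /andP[lc cp]; apply/subsetP => x.
have cl : Some c != Some l by apply: contraTneq lc => -[->]; rewrite adj_irr.
have avoid_p y : y \in branch c (Some l) -> Some y != p.
  case: p lp cp => // p' /= lp cp /(neighbour_branch lc) cy.
  by apply: contraTneq lp => -[yp]; move: cp; rewrite -yp; apply: contra => /cy->.
have c_in : c \in branch l p by rewrite inE connect1 // /avoid /= lc cp rooted_neq.
rewrite inE => /connectP[s]; elim/last_ind: s x => [|s y IH] x /=; first by move=> _ ->.
rewrite rcons_path last_rcons => /andP[path_s step_y] ->.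
have z_in : last c s \in branch l p by apply: IH.
have z_c : last c s \in branch c (Some l) by rewrite inE; apply/connectP; exists s.
have y_c : y \in branch c (Some l).
  by move: z_c; rewrite !inE => z_c; apply: connect_trans z_c (connect1 step_y).
rewrite inE in z_in; rewrite inE (connect_trans z_in) // connect1 // /avoid /= !avoid_p //.
by case/and3P: step_y.
Qed.

Lemma notin_branch_child l p c : c \in children adj l p -> l \notin branch c (Some l).
Proof.
rewrite mem_children => /andP[lc _]; apply/negP => /branch_avoid; rewrite eqxx.
by case/(_ _)/negP=> //; apply: contraTneq lc => -[->]; rewrite adj_irr.
Qed.

Lemma disjoint_branches l p c1 c2 x :
  c1 \in children adj l p -> c2 \in children adj l p ->
  x \in branch c1 (Some l) -> x \in branch c2 (Some l) -> c1 = c2.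
Proof.
rewrite !mem_children => /andP[lc1 _] /andP[lc2 _]; rewrite !inE => c1x c2x.
apply: neighbour_branch lc1 lc2 _; rewrite inE (connect_trans c1x) //.
by rewrite (sym_connect_sym (@avoid_sym _)).
Qed.

Lemma branchP l p x : rooted_at l p ->
  reflect (x = l \/ exists2 c, c \in children adj l p & x \in branch c (Some l))
          (x \in branch l p).
Proof.
move=> lp; apply: (iffP idP) => [|[->|[c /(sub_branch lp)/subsetP sub /sub]]] //; last first.
  exact: branch_refl.
rewrite inE => /connectP[s0 path0 ->]; case/shortenP: path0 => -[|c s] /=; first by left.
case/andP=> /and3P[_ cp lc] path_s /andP[l_s _] _; right; exists c.
  by rewrite mem_children lc.
rewrite inE; apply/connectP; exists s => //.
elim: s c l_s path_s {cp lc} => //= y s IH c.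
rewrite !in_cons !negb_or => /and3P[lc ly l_s] /andP[/and3P[_ _ cy] path_s].
rewrite (IH y) ?inE ?negb_or ?ly //= andbT /avoid /= cy !(inj_eq Some_inj).
by rewrite eq_sym lc eq_sym ly.
Qed.

(** The branches of two children are disjoint, because a common node would join
    two neighbours of [l] by a path that misses [l]. *)
Lemma big_branch (V : Type) (idx : V) (op : Monoid.com_law idx) (F : N -> V) l p :
  rooted_at l p ->
  \big[op/idx]_(x in branch l p) F x
    = op (F l) (\big[op/idx]_(c <- children adj l p)
                  \big[op/idx]_(x in branch c (Some l)) F x).
Proof.
move=> lp; rewrite (bigD1 l) ?branch_refl //=; congr (op _ _).
rewrite /children big_filter big_enum_cond /=.
rewrite (exchange_big_dep (fun x => (x \in branch l p) && (x != l))) /=; last first.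
  move=> c x; rewrite -[_ && (_ != p)]mem_children => c_in x_in.
  rewrite (subsetP (sub_branch lp c_in)) //=.
  by apply: contraTneq x_in => ->; apply: notin_branch_child c_in.
apply: eq_bigr => x /andP[/(branchP _ lp)[->|[c0 c0_in x_in]]]; first by rewrite eqxx.
move=> _; rewrite (big_pred1 c0) // => c; apply/andP/eqP => [[]|->].
  by rewrite -mem_children => c_in xc; apply: disjoint_branches c_in c0_in xc x_in.
by rewrite -mem_children.
Qed.

End Branches.

(** * Restriction to a set of vertices *)

Section Selection.

Variables (R : realFieldType) (n : nat).
Implicit Types X Y : {set 'I_n}.

(** With this projector, being supported on [X] is the equation [proj X *m A = A]. *)
Definition proj X : 'M[R]_n := (sel R X)^T *m sel R X.

Lemma mul_sel X k (A : 'M[R]_(n, k)) :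
  sel R X *m A = rowsub (enum_val (A := mem X)) A.
Proof. by rewrite mul_rowsub_mx mul1mx. Qed.

Lemma mul_tr_sel X k (A : 'M[R]_(k, n)) :
  A *m (sel R X)^T = colsub (enum_val (A := mem X)) A.
Proof. by apply: trmx_inj; rewrite trmx_mul trmxK mul_sel; apply/matrixP => i j; rewrite !mxE. Qed.

Lemma mul_sel2 X Y (A : 'M[R]_n) :
  sel R X *m A *m (sel R Y)^T
    = mxsub (enum_val (A := mem X)) (enum_val (A := mem Y)) A.
Proof. by rewrite mul_sel mul_tr_sel; apply/matrixP => i j; rewrite !mxE. Qed.

Lemma projE X : proj X = diag_mx (\row_u (u \in X)%:R).
Proof.
apply/matrixP => u v; rewrite !mxE.
under eq_bigr => k _ do rewrite !mxE.
rewrite -(big_enum_val (fun w => (w == u)%:R * (w == v)%:R)) /=.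
case: (boolP (u \in X)) => uX; last first.
  rewrite mul0rn big1 // => w wX; case: eqP => [wu|]; last by rewrite mul0r.
  by rewrite -wu wX in uX.
rewrite (bigD1 u) //= eqxx mul1r big1 ?addr0 // => w /andP[_ /negPf->].
by rewrite mul0r.
Qed.

Lemma proj_tr X : (proj X)^T = proj X.
Proof. by rewrite trmx_mul trmxK. Qed.

Lemma proj_mul X Y : proj X *m proj Y = proj (X :&: Y).
Proof.
rewrite !projE mulmx_diag; congr diag_mx; apply/rowP => u; rewrite !mxE inE.
by rewrite -natrM mulnb.
Qed.

Lemma proj_setU X Y : [disjoint X & Y] -> proj (X :|: Y) = proj X + proj Y.
Proof.
move=> dXY; rewrite !projE -raddfD; congr diag_mx; apply/rowP => u; rewrite !mxE inE.
case: (boolP (u \in X)) => [uX|_]; last by rewrite add0r.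
by rewrite (disjointFr dXY uX) addr0.
Qed.

Lemma proj_set0 : proj set0 = 0.
Proof.
by rewrite projE; apply/matrixP => u v; rewrite !mxE in_set0 mul0rn.
Qed.

Lemma sel_orth X : sel R X *m (sel R X)^T = 1%:M.
Proof.
have -> : sel R X = sel R X *m 1%:M by rewrite mulmx1.
rewrite trmx_mul trmx1 mul1mx mul_sel2; apply/matrixP => i j; rewrite !mxE.
by rewrite (inj_eq enum_val_inj).
Qed.

Lemma sel_proj X : sel R X *m proj X = sel R X.
Proof. by rewrite mulmxA sel_orth mul1mx. Qed.

End Selection.

(** * Lists of constraint rows *)

Section RowLists.

Variables (R : realFieldType) (n M : nat).
Implicit Types (s : seq (crow R n M)) (z : 'cV[R]_n * 'cV[R]_M) (X : {set 'I_n}).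

Definition sat z (r : crow R n M) : bool := (coef r *m z.1) 0 0 == rhs r.

Definition rows_on X s : bool := all (fun r => coef r *m proj R X == coef r) s.

Lemma row_coefs_on X s : rows_on X s -> row_coefs s *m proj R X = row_coefs s.
Proof.
move=> /(@all_tnthP _ _ _ (in_tuple s)) on; apply/row_matrixP => i.
by rewrite row_mul rowK; apply/eqP; apply: (on i).
Qed.

Lemma all_satP z s :
  reflect (row_coefs s *m z.1 = row_rhs s) (all (sat z) s).
Proof.
apply: (iffP (@all_tnthP _ _ (sat z) (in_tuple s))) => [sat_s|eq_s i].
  apply/colP => i; rewrite mxE [RHS]mxE -(eqP (sat_s i)) mxE.
  by apply: eq_bigr => u _; rewrite mxE.
apply/eqP; move/colP/(_ i): eq_s; rewrite mxE [RHS]mxE => <-; rewrite mxE.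
by apply: eq_bigr => u _; rewrite mxE.
Qed.

Lemma sum_rows s (mu : 'cV[R]_M) :
  \sum_(r <- s) mu (lab r) 0 *: (coef r)^T = (row_coefs s)^T *m rowsub (@row_labels R n M s) mu.
Proof.
apply/colP => u; rewrite summxE mxE big_tnth; apply: eq_bigr => i _.
by rewrite !mxE mulrC.
Qed.

Lemma row_coefs_cat s1 s2 :
  row_coefs (s1 ++ s2)
    = castmx (esym (size_cat s1 s2), erefl n) (col_mx (row_coefs s1) (row_coefs s2)).
Proof.
apply/matrixP => i j; rewrite castmxE /= cast_ord_id mxE.
set d := tnth (in_tuple (s1 ++ s2)) i; rewrite [d](tnth_nth d) /=.
rewrite nth_cat; set k := cast_ord _ i; have kE : k = i :> nat by [].
rewrite -kE; case: (split_ordP k) => k' ->; rewrite ?col_mxEu ?col_mxEd mxE /=.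
  by rewrite (tnth_nth d).
by rewrite addKn (tnth_nth d).
Qed.

Definition indep s : bool := row_free (row_coefs s).

Lemma indep_catE s1 s2 :
  indep (s1 ++ s2) = row_free (col_mx (row_coefs s1) (row_coefs s2)).
Proof. by rewrite /indep row_coefs_cat row_free_castmx. Qed.

Lemma indep_catl s1 s2 : indep (s1 ++ s2) -> indep s1.
Proof.
rewrite indep_catE => /row_free_inj inj; apply: inj_row_free => v v0.
have : row_mx v (0 : 'rV_(size s2)) = 0 by apply: inj; rewrite mul_row_col v0 !mul0mx addr0.
by rewrite -row_mx0 => /eq_row_mx[].
Qed.

Lemma indep_catr s1 s2 : indep (s1 ++ s2) -> indep s2.
Proof.
rewrite indep_catE => /row_free_inj inj; apply: inj_row_free => v v0.
have : row_mx (0 : 'rV_(size s1)) v = 0 by apply: inj; rewrite mul_row_col v0 !mul0mx addr0.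
by rewrite -row_mx0 => /eq_row_mx[].
Qed.

(** Independent rows supported on [X] embed into a space of dimension [#|X|]. *)
Lemma indep_size X s : rows_on X s -> indep s -> (size s <= #|X|)%N.
Proof.
move=> /row_coefs_on on_X /eqP rk; have: (\rank (row_coefs s) <= #|X|)%N; last by rewrite rk.
by rewrite -on_X mulmxA (leq_trans (mxrankM_maxr _ _)) // rank_leq_row.
Qed.

End RowLists.

(** * One elimination step *)

Section Elimination.

Variables (R : realFieldType) (n M : nat).
Implicit Types (a : local_qp R n M) (z : 'cV[R]_n * 'cV[R]_M) (F : front R n M).
Implicit Types (s : step R n M) (X : {set 'I_n}).

(** The gradient at [z.1] of the Lagrangian of the program held by [a], with
    multipliers [z.2]. *)
Definition vres a z : 'cV[R]_n :=
  lQ a *m z.1 + \sum_(r <- lrows a) z.2 (lab r) 0 *: (coef r)^T - lb a.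

Definition on_bag X a : Prop :=
  [/\ (lQ a)^T = lQ a, proj R X *m lQ a = lQ a, proj R X *m lb a = lb a
    & rows_on X (lrows a)].

Lemma vres_on_bag X a z : on_bag X a -> proj R X *m vres a z = vres a z.
Proof.
case=> _ QX bX /row_coefs_on GX.
have GX' : proj R X *m (row_coefs (lrows a))^T = (row_coefs (lrows a))^T.
  by rewrite -[proj _ _]proj_tr -trmx_mul GX.
by rewrite /vres sum_rows mulmxBr mulmxDr !mulmxA QX bX GX'.
Qed.

Definition front_bag F : {set 'I_n} := iota_set F :|: xi_set F.

Definition wf_front F : Prop :=
  [disjoint iota_set F & xi_set F] /\ on_bag (front_bag F) (acc F).

Definition read_P F z : 'cV[R]_(Pdim F) :=
  col_mx (rowsub (enum_val (A := mem (iota_set F))) z.1)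
         (rowsub (@row_labels R n M (elim_rows F)) z.2).

Definition solves z F : bool := JPP F *m read_P F z + JPR F *m read_R F z == gP F.

Section Blocks.
Variable F : front R n M.

Let E1 : 'M[R]_(#|iota_set F|, n) := sel R (iota_set F).
Let E2 : 'M[R]_(#|xi_set F|, n) := sel R (xi_set F).
Let G1 := row_coefs (elim_rows F).
Let G2 := row_coefs (kept_rows F).
Let Q := lQ (acc F).

Lemma JPPE : JPP F = block_mx (E1 *m Q *m E1^T) (G1 *m E1^T)^T (G1 *m E1^T) 0.
Proof. by rewrite /JPP mul_sel2 mul_tr_sel. Qed.

Lemma JPRE : JPR F = block_mx (E1 *m Q *m E2^T) (G2 *m E1^T)^T (G1 *m E2^T) 0.
Proof. by rewrite /JPR mul_sel2 !mul_tr_sel. Qed.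

Lemma JRPE : JRP F = block_mx (E1 *m Q *m E2^T)^T (G1 *m E2^T)^T (G2 *m E1^T) 0.
Proof. by rewrite /JRP mul_sel2 !mul_tr_sel. Qed.

Lemma JRRE : JRR F = block_mx (E2 *m Q *m E2^T) (G2 *m E2^T)^T (G2 *m E2^T) 0.
Proof. by rewrite /JRR mul_sel2 mul_tr_sel. Qed.

Lemma gPE : gP F = col_mx (E1 *m lb (acc F)) (row_rhs (elim_rows F)).
Proof. by rewrite /gP mul_sel. Qed.

Lemma gRE : gR F = col_mx (E2 *m lb (acc F)) (row_rhs (kept_rows F)).
Proof. by rewrite /gR mul_sel. Qed.

Lemma read_PE z : read_P F z
  = col_mx (E1 *m z.1) (rowsub (@row_labels R n M (elim_rows F)) z.2).
Proof. by rewrite /read_P mul_sel. Qed.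

Lemma read_RE z : read_R F z
  = col_mx (E2 *m z.1) (rowsub (@row_labels R n M (kept_rows F)) z.2).
Proof. by rewrite /read_R mul_sel. Qed.

Lemma front_rows : lrows (acc F) = elim_rows F ++ kept_rows F.
Proof. by rewrite cat_take_drop. Qed.

Hypothesis wfF : wf_front F.

Let Qsym : Q^T = Q. Proof. by case: wfF => _ []. Qed.

Let projF : proj R (front_bag F) = E1^T *m E1 + E2^T *m E2.
Proof. by case: wfF => dis _; rewrite proj_setU. Qed.

Let Qsplit k (A : 'M[R]_(k, n)) :
  A *m Q *m E1^T *m E1 + A *m Q *m E2^T *m E2 = A *m Q.
Proof.
rewrite -!mulmxA -!mulmxDr -projF; congr (A *m _).
by case: wfF => _ [_ /(congr1 trmx) + _ _]; rewrite trmx_mul proj_tr Qsym.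
Qed.

Let rows_split : rows_on (front_bag F) (elim_rows F) /\ rows_on (front_bag F) (kept_rows F).
Proof. by case: wfF => _ [_ _ _]; rewrite front_rows /rows_on all_cat => /andP[]. Qed.

Let G1split : G1 *m E1^T *m E1 + G1 *m E2^T *m E2 = G1.
Proof. by rewrite -!mulmxA -mulmxDr -projF row_coefs_on //; case: rows_split. Qed.

Let G2split : G2 *m E1^T *m E1 + G2 *m E2^T *m E2 = G2.
Proof. by rewrite -!mulmxA -mulmxDr -projF row_coefs_on //; case: rows_split. Qed.

Lemma vres_front z : vres (acc F) z = Q *m z.1
  + (G1^T *m rowsub (@row_labels R n M (elim_rows F)) z.2
     + G2^T *m rowsub (@row_labels R n M (kept_rows F)) z.2) - lb (acc F).
Proof. by rewrite /vres front_rows big_cat /= !sum_rows. Qed.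

Lemma pivot_residual z : JPP F *m read_P F z + JPR F *m read_R F z - gP F
  = col_mx (E1 *m vres (acc F) z) (G1 *m z.1 - row_rhs (elim_rows F)).
Proof.
rewrite JPPE JPRE gPE read_PE read_RE !mul_block_col add_col_mx opp_col_mx add_col_mx.
congr col_mx.
  rewrite vres_front mulmxBr !mulmxDr; congr (_ - _).
  rewrite addrACA !trmx_mul !trmxK -!mulmxA; congr (_ + _).
  by rewrite !mulmxA -mulmxDl Qsplit.
by rewrite !mul0mx !addr0 !mulmxA -mulmxDl G1split.
Qed.

Lemma rest_residual z : JRP F *m read_P F z + JRR F *m read_R F z - gR F
  = col_mx (E2 *m vres (acc F) z) (G2 *m z.1 - row_rhs (kept_rows F)).
Proof.
rewrite JRPE JRRE gRE read_PE read_RE !mul_block_col add_col_mx opp_col_mx add_col_mx.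
congr col_mx.
  rewrite vres_front mulmxBr !mulmxDr; congr (_ - _).
  rewrite addrACA !trmx_mul !trmxK Qsym -!mulmxA; congr (_ + _).
  by rewrite !mulmxA -mulmxDl Qsplit.
by rewrite !mul0mx !addr0 !mulmxA -mulmxDl G2split.
Qed.

Lemma JPP_tr : (JPP F)^T = JPP F.
Proof. by rewrite JPPE tr_block_mx trmx0 trmxK !trmx_mul !trmxK Qsym mulmxA. Qed.

Lemma JPR_tr : (JPR F)^T = JRP F.
Proof. by rewrite JPRE JRPE tr_block_mx trmx0 trmxK. Qed.

Lemma JRR_tr : (JRR F)^T = JRR F.
Proof. by rewrite JRRE tr_block_mx trmx0 trmxK !trmx_mul !trmxK Qsym mulmxA. Qed.

End Blocks.

(** The contents of a step in terms of the true inverse of the pivot block,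
    instead of the output of the linear solver. *)
Definition factorized s : Prop :=
  [/\ JPP (fr s) \in unitmx,
      pivot_inv s = invmx (JPP (fr s)),
      msgJ s = JRR (fr s) - JRP (fr s) *m invmx (JPP (fr s)) *m JPR (fr s) &
      msgg s = gR (fr s) - JRP (fr s) *m invmx (JPP (fr s)) *m gP (fr s)].

Lemma factorizeE I X a : (factorize I X a).1 =
  let F := Front a I X
    (gauss_rank (mxsub (enum_val (A := mem I)) (enum_val (A := mem I)) (lQ a))).1 in
  let K := (gauss_solve (JPP F) 1%:M).1 in
  @Step R n M F K (JRR F - JRP F *m K *m JPR F) (gR F - JRP F *m K *m gP F).
Proof. by []. Qed.

Lemma factorizeP I X a : JPP (fr (factorize I X a).1) \in unitmx ->
  factorized (factorize I X a).1.
Proof.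
rewrite factorizeE; set F := Front _ _ _ _; move=> /= unitP.
by split; rewrite //= gauss_solveE // mulmx1.
Qed.

Lemma factorize_front I X a :
  exists r, fr (factorize I X a).1 = Front a I X r.
Proof. by rewrite factorizeE /=; eexists. Qed.

Section Message.
Variable s : step R n M.
Hypotheses (fs : factorized s) (wfs : wf_front (fr s)).
Local Notation F := (fr s).

Lemma msgJ_tr : (msgJ s)^T = msgJ s.
Proof.
case: fs => _ _ -> _; rewrite linearB /= !trmx_mul trmx_inv JPP_tr // JRR_tr // JPR_tr //.
by rewrite -[(JRP F)^T]trmxK -JPR_tr // !trmxK mulmxA.
Qed.

(** The pivot equations force z_P = J_PP^-1 (g_P - J_PR z_R); substituting this
    in the remaining equations produces the Schur complement. *)
Lemma msg_residual z : solves z F -> msgJ s *m read_R F z - msgg s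
  = JRP F *m read_P F z + JRR F *m read_R F z - gR F.
Proof.
case: fs => uP _ -> -> sol.
have -> : read_P F z = invmx (JPP F) *m (gP F - JPR F *m read_R F z).
  by rewrite -(eqP sol) addrK mulKmx.
rewrite mulmxBl !mulmxBr !mulmxA opprB addrA; congr (_ - _).
by rewrite addrC addrA addrAC.
Qed.

Let ursub_msgJ : ursubmx (msgJ s) = (dlsubmx (msgJ s))^T.
Proof. by rewrite trmx_dlsub msgJ_tr. Qed.

(** On the interior vertices the gradient of the collected data vanishes, by the
    pivot equations; on the boundary vertices it is the message's, because the
    Schur complement is symmetric. *)
Lemma message_vres z : solves z F -> vres (message s) z = vres (acc F) z.
Proof.
move=> sol; have := msg_residual sol; rewrite rest_residual // => /(congr1 usubmx).
rewrite col_mxKu -[msgJ s]submxK -[msgg s]vsubmxK read_RE mul_block_col opp_col_mx.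
rewrite add_col_mx col_mxKu => res_xi.
have := pivot_residual wfs z; rewrite (eqP sol) subrr => /esym/(congr1 usubmx).
rewrite linear0 col_mxKu => res_iota.
have [disF bagF] := wfs; rewrite -[RHS](vres_on_bag z bagF) proj_setU //.
rewrite mulmxDl -mulmxA res_iota mulmx0 add0r -mulmxA -res_xi.
rewrite /vres /= big_map big_enum /= mulmxBr mulmxDr !mulmxA; congr (_ + _ - _).
rewrite ursub_msgJ -trmx_mul; apply/colP => u; rewrite summxE mxE.
by apply: eq_bigr => k _; rewrite !mxE mulrC.
Qed.

Lemma elim_sat z : solves z F -> all (sat z) (elim_rows F).
Proof.
move=> sol; have := pivot_residual wfs z; rewrite (eqP sol) subrr => /esym/(congr1 dsubmx).
by rewrite linear0 col_mxKd => /eqP; rewrite subr_eq0 => /eqP/all_satP.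
Qed.

Lemma msg_dsub z : solves z F -> dsubmx (msgJ s *m read_R F z - msgg s)
  = row_coefs (kept_rows F) *m z.1 - row_rhs (kept_rows F).
Proof. by move=> sol; rewrite msg_residual // rest_residual // col_mxKd. Qed.

(** Without its constraint-constraint block, the Schur complement acts on the
    kept rows as the coefficient matrix of the message. *)
Lemma message_sat z : solves z F -> drsubmx (msgJ s) = 0 ->
  all (sat z) (lrows (message s)) -> all (sat z) (lrows (acc F)).
Proof.
move=> sol dr0 sat_msg; rewrite front_rows all_cat elim_sat //=; apply/all_satP.
apply/eqP; rewrite -subr_eq0 -msg_dsub // -[msgJ s]submxK -[msgg s]vsubmxK read_RE.
rewrite mul_block_col opp_col_mx add_col_mx col_mxKd dr0 mul0mx addr0 mulmxA subr_eq0.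
apply/eqP/colP => k; move: sat_msg; rewrite /= all_map => /allP/(_ k (mem_enum _ _)).
by rewrite /sat /= => /eqP <-; rewrite -row_mul [RHS]mxE.
Qed.

Lemma root_sat z : solves z F -> msgJ s *m read_R F z = msgg s ->
  all (sat z) (lrows (acc F)).
Proof.
move=> sol sol_R; rewrite front_rows all_cat elim_sat //=; apply/all_satP/eqP.
by rewrite -subr_eq0 -msg_dsub // sol_R subrr linear0.
Qed.

Lemma message_bag : on_bag (xi_set F) (message s).
Proof.
split=> /=.
- by rewrite !trmx_mul trmxK trmx_ulsub msgJ_tr mulmxA.
- by rewrite !mulmxA -[proj _ _]proj_tr -trmx_mul sel_proj.
- by rewrite !mulmxA -[proj _ _]proj_tr -trmx_mul sel_proj.
by rewrite /rows_on all_map; apply/allP => k _ /=; rewrite -row_mul -mulmxA sel_proj.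
Qed.

End Message.

Lemma message_labels s :
  map (@lab R n M) (lrows (message s)) = map (@lab R n M) (kept_rows (fr s)).
Proof.
have kept_enum := map_tnth_enum (in_tuple (kept_rows (fr s))).
by apply: etrans (congr1 (map (@lab R n M)) kept_enum); rewrite /= -!map_comp.
Qed.

Lemma indep_enum k (f : 'I_k -> crow R n M) :
  indep [seq f i | i <- enum 'I_k] = row_free (\matrix_i coef (f i)).
Proof.
have sz : size [seq f i | i <- enum 'I_k] = k by rewrite size_map size_enum_ord.
rewrite /indep -(row_free_castmx _ (sz, erefl n)); congr (row_free _).
apply/matrixP => i j; rewrite castmxE /= cast_ord_id !mxE (tnth_nth (f i)) /=.
by rewrite (nth_map i) ?size_enum_ord // nth_ord_enum.
Qed.

(** A dependence between the collected rows survives elimination: its pivot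
    part is absorbed by the pivot block, and what is left is a dependence
    between the kept rows of the message. *)
Lemma message_indep s : factorized s -> indep (lrows (message s)) ->
  indep (lrows (acc (fr s))).
Proof.
case=> uP _ SE _; rewrite indep_enum /= => /row_free_inj inj.
rewrite front_rows indep_catE; apply: inj_row_free => y.
rewrite -[y]hsubmxK; set y1 := lsubmx y; set y2 := rsubmx y; rewrite mul_row_col => y0.
have y0' : y2 *m row_coefs (kept_rows (fr s)) = - (y1 *m row_coefs (elim_rows (fr s))).
  by apply/eqP; rewrite -addr_eq0 addrC y0.
have v0 : row_mx 0 y2 *m msgJ s = 0.
  rewrite SE mulmxBr !mulmxA JRPE JRRE !mul_row_block !mul0mx !mulmx0 !add0r.
  rewrite !mulmxA y0' !mulNmx.
  (* The kept part acts on the interior vertices as minus the pivot part, and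
     that is a combination of rows of the pivot block. *)
  have -> : row_mx (- (y1 *m row_coefs (elim_rows (fr s)) *m (sel R (iota_set (fr s)))^T)) 0
      = - row_mx 0 y1 *m JPP (fr s).
    by rewrite JPPE mulNmx mul_row_block !mul0mx !mulmx0 !add0r opp_row_mx oppr0 mulmxA.
  rewrite mulmxK // JPRE mulNmx mul_row_block !mul0mx !mulmx0 !add0r opp_row_mx oppr0.
  by rewrite mulmxA subrr.
have y20 : y2 = 0.
  apply: inj; rewrite mul0mx.
  have -> : \matrix_i row i (dlsubmx (msgJ s) *m sel R (xi_set (fr s)))
      = dlsubmx (msgJ s) *m sel R (xi_set (fr s)) by apply/row_matrixP => i; rewrite rowK.
  move: v0; rewrite -[msgJ s]submxK mul_row_block !mul0mx !add0r -row_mx0 => /eq_row_mx[v0 _].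
  by rewrite mulmxA; move: v0; rewrite !submxK => ->; rewrite mul0mx.
move: y0'; rewrite y20 mul0mx => /esym/eqP; rewrite oppr_eq0 => /eqP y10.
suff: row_mx (0 : 'rV_#|iota_set (fr s)|) y1 = 0.
  by rewrite -row_mx0 => /eq_row_mx[_ ->]; rewrite row_mx0.
apply: (can_inj (mulmxK uP)).
by rewrite JPPE mul_row_block !mul0mx !mulmx0 !add0r mulmxA y10 mul0mx row_mx0.
Qed.

(** A dependence between the rows is a left kernel vector of J, because the
    constraint-constraint blocks of J are zero. *)
Lemma Jmx_indep F : Jmx F \in unitmx -> indep (lrows (acc F)).
Proof.
move=> uJ; rewrite front_rows indep_catE; apply: inj_row_free => y.
rewrite -[y]hsubmxK; set y1 := lsubmx y; set y2 := rsubmx y; rewrite mul_row_col => y0.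
suff: row_mx (row_mx (0 : 'rV_#|xi_set F|) y2) (row_mx (0 : 'rV_#|iota_set F|) y1) = 0.
  by rewrite -!row_mx0 => /eq_row_mx[/eq_row_mx[_ ->] /eq_row_mx[_ ->]].
apply: (can_inj (mulmxK uJ)); rewrite mul0mx /Jmx JRRE JRPE JPRE JPPE.
rewrite mul_row_block !mul_row_block !mul0mx !mulmx0 !add0r !add_row_mx !addr0 !mulmxA -!mulmxDl.
by rewrite [_ + y1 *m _]addrC y0 !mul0mx !row_mx0.
Qed.

Lemma Jmx_msgJ s : factorized s -> Jmx (fr s) \in unitmx -> msgJ s \in unitmx.
Proof.
case=> uP _ SE _.
have -> : Jmx (fr s) = block_mx 1%:M (JRP (fr s) *m invmx (JPP (fr s))) 0 1%:M
    *m block_mx (msgJ s) 0 (JPR (fr s)) (JPP (fr s)).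
  by rewrite mulmx_block !mul1mx !mul0mx !add0r SE subrK mulmxKV.
rewrite unitmx_mul => /andP[_]; rewrite unitmxE det_lblock unitrM => /andP[].
by rewrite unitmxE.
Qed.

End Elimination.

(** * Back-substitution *)

Section BackSubstitution.

Variables (R : realFieldType) (n M : nat).
Implicit Types (s : step R n M) (z : 'cV[R]_n * 'cV[R]_M) (v : 'I_n + 'I_M).

Definition labels (rs : seq (crow R n M)) : seq 'I_M := map (@lab R n M) rs.

Lemma labels_front (F : front R n M) :
  labels (lrows (acc F)) = labels (elim_rows F) ++ labels (kept_rows F).
Proof. by rewrite /labels -map_cat -front_rows. Qed.

(** A variable is a vertex or a multiplier; the summands of ['I_n + 'I_M] let one
    argument treat both. *)
Definition pivots s (v : 'I_n + 'I_M) : bool :=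
  match v with inl u => u \in iota_set (fr s) | inr k => k \in labels (elim_rows (fr s)) end.

Definition rest s (v : 'I_n + 'I_M) : bool :=
  match v with inl u => u \in xi_set (fr s) | inr k => k \in labels (kept_rows (fr s)) end.

Definition separated (P Q : pred ('I_n + 'I_M)) : bool := [forall v, ~~ (P v && Q v)].

(** Back-substitution in [s1] leaves the equations of [s2] intact, so that it
    may follow that in [s2]. *)
Definition decoupled s1 s2 : bool := separated (pivots s1) (predU (pivots s2) (rest s2)).

Lemma separatedP (P Q : pred ('I_n + 'I_M)) :
  reflect (forall v, P v -> Q v -> False) (separated P Q).
Proof.
apply: (iffP forallP) => [sep v Pv Qv|sep v]; first by have := sep v; rewrite Pv Qv.
by apply/negP => /andP[]; apply: sep.
Qed.

Definition val_at z v : R :=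
  match v with inl u => z.1 u 0 | inr k => z.2 k 0 end.

Lemma assignK k K (f : 'I_k -> 'I_K) (y : 'cV[R]_k) x :
  injective f -> rowsub f (assign f y x) = y.
Proof.
move=> inj; apply/colP => i; rewrite !mxE; case: pickP => [j /eqP/inj->|/(_ i)] //.
by rewrite eqxx.
Qed.

Lemma assign_out k K (f : 'I_k -> 'I_K) (y : 'cV[R]_k) x u :
  (forall i, f i != u) -> assign f y x u 0 = x u 0.
Proof. by move=> out; rewrite mxE; case: pickP => // i; rewrite (negPf (out i)). Qed.

Lemma row_labels_inj (rs : seq (crow R n M)) :
  uniq (labels rs) -> injective (@row_labels R n M rs).
Proof.
move=> uniq_rs i j; have d := tnth (in_tuple rs) i.
rewrite /row_labels !(tnth_nth d) /= -!(nth_map d (lab d) (@lab R n M)) //= => /eqP.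
by rewrite nth_uniq ?size_map // => /eqP/val_inj.
Qed.

Lemma row_labels_mem (rs : seq (crow R n M)) i : @row_labels R n M rs i \in labels rs.
Proof.
have d := tnth (in_tuple rs) i.
by rewrite /row_labels (tnth_nth d) /= -(nth_map d (lab d) (@lab R n M)) // mem_nth ?size_map.
Qed.

Lemma eq_read_P s z z' : (forall v, pivots s v -> val_at z v = val_at z' v) ->
  read_P (fr s) z = read_P (fr s) z'.
Proof.
move=> eqz; congr col_mx; apply/colP => i; rewrite !mxE.
  by apply: (eqz (inl _)); apply: enum_valP.
by apply: (eqz (inr _)); apply: row_labels_mem.
Qed.

Lemma eq_read_R s z z' : (forall v, rest s v -> val_at z v = val_at z' v) ->
  read_R (fr s) z = read_R (fr s) z'.
Proof.
move=> eqz; congr col_mx; apply/colP => i; rewrite !mxE.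
  by apply: (eqz (inl _)); apply: enum_valP.
by apply: (eqz (inr _)); apply: row_labels_mem.
Qed.

Lemma write_P_out s (zP : 'cV_(Pdim (fr s))) z v :
  ~~ pivots s v -> val_at (write_P zP z) v = val_at z v.
Proof.
case: v => [u|k] /= out; apply: assign_out => i; apply: contraNneq out => <-.
  exact: enum_valP.
exact: row_labels_mem.
Qed.

Lemma read_write_P s (zP : 'cV_(Pdim (fr s))) z :
  uniq (labels (elim_rows (fr s))) -> read_P (fr s) (write_P zP z) = zP.
Proof.
move=> uniq_s; rewrite /read_P /write_P /= !assignK ?vsubmxK //; first exact: row_labels_inj.
exact: enum_val_inj.
Qed.

Lemma read_write_R s (zR : 'cV_(Rdim (fr s))) z :
  uniq (labels (kept_rows (fr s))) -> read_R (fr s) (write_R zR z) = zR.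
Proof.
move=> uniq_s; rewrite /read_R /write_R /= !assignK ?vsubmxK //; first exact: row_labels_inj.
exact: enum_val_inj.
Qed.

Definition back z (ss : seq (step R n M)) : 'cV[R]_n * 'cV[R]_M :=
  foldl (fun z s => (back_substitute z s).1) z ss.

Definition pivot_values s z : 'cV[R]_(Pdim (fr s)) :=
  pivot_inv s *m (gP (fr s) - JPR (fr s) *m read_R (fr s) z).

Lemma back_cons z s ss : back z (s :: ss) = back (write_P (pivot_values s z) z) ss.
Proof. by []. Qed.

Lemma back_out z ss v : all (fun s => ~~ pivots s v) ss -> val_at (back z ss) v = val_at z v.
Proof.
elim: ss z => // s ss IH z /andP[out_s out_ss].
by rewrite back_cons IH // write_P_out.
Qed.

Definition invertible s : bool :=
  (JPP (fr s) \in unitmx) && (pivot_inv s == invmx (JPP (fr s))).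

(** Each step solves its own pivot equations, and no later step overwrites a
    variable occurring in them. *)
Lemma back_solves z ss :
  all invertible ss ->
  all (fun s => uniq (labels (lrows (acc (fr s)))) && separated (pivots s) (rest s)) ss ->
  pairwise (fun s1 s2 => decoupled s2 s1) ss ->
  all (fun s => solves (back z ss) (fr s)) ss.
Proof.
elim: ss z => // s ss IH z /andP[/andP[uP /eqP invP] inv_ss].
move=> /andP[/andP[uniq_s /separatedP sep_s] uniq_ss]; rewrite pairwise_cons => /andP[dec_s dec_ss].
rewrite back_cons; set z1 := write_P _ z; apply/andP; split; last exact: IH.
have out v : pivots s v || rest s v -> all (fun s' => ~~ pivots s' v) ss.
  move=> sv; apply: sub_all dec_s => s' /separatedP dec; apply/negP => pv.
  exact: (dec v pv sv).
rewrite /solves (eq_read_P (z' := z1)); last by move=> v sv; rewrite back_out // out // sv.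
rewrite (eq_read_R (z' := z)) => [|v sv]; last first.
  rewrite back_out; last by rewrite out // sv orbT.
  by rewrite /z1 write_P_out //; apply/negP => /sep_s/(_ sv).
rewrite /z1 read_write_P; last by move: uniq_s; rewrite labels_front cat_uniq => /and3P[].
by rewrite /pivot_values invP mulKVmx // subrK.
Qed.

End BackSubstitution.

(** * Operation counts *)

Section Costs.

Variable R : realFieldType.

Lemma gauss_rank_cost m k (A : 'M[R]_(m, k)) : ((gauss_rank A).2 <= 4 * m * m * k)%N.
Proof.
elim: m k A => [|m IH] [|k] A //=.
case: pickP => [[i j] _|_]; rewrite /bind /=; last by nia.
set r := gauss_rank _; have : (r.2 <= 4 * m * m * k)%N by apply: IH.
by nia.
Qed.

Lemma gauss_solve_cost m k (A : 'M[R]_m) (B : 'M[R]_(m, k)) :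
  ((gauss_solve A B).2 <= 5 * m * m * (m + k))%N.
Proof.
elim: m A B => [|m IH] A B //=; rewrite /bind /=.
set r := gauss_solve _ _; have : (r.2 <= 5 * m * m * (m + k))%N by apply: IH.
by nia.
Qed.

(** Here [i], [p] and [d] stand for the numbers of interior vertices, of pivots
    and of remaining unknowns, [r] for the cost of the rank and [t] for that of
    the inversion. *)
Lemma cost_arith i p d w r t :
  (0 < w)%N -> (i <= w)%N -> (p <= 2 * w)%N -> (d <= 2 * w)%N ->
  (r <= 4 * i * i * i)%N -> (t <= 5 * p * p * (p + p))%N ->
  (r + (t + (d * p * (2 * p) + (d * d * (2 * p) + (d * d + (d * 1 * (2 * p) + (d * 1 + 0))))))
    <= 130 * w ^ 3)%N.
Proof.
move=> w_gt0 iw pw dw r_bound t_bound.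
have r_le : (4 * i * i * i <= 4 * w * w * w)%N by rewrite !leq_mul.
have t_le : (5 * p * p * (p + p) <= 5 * (2 * w) * (2 * w) * (2 * w + 2 * w))%N.
  by rewrite !leq_mul ?leq_add.
have d1 : (d * p * (2 * p) <= (2 * w) * (2 * w) * (2 * (2 * w)))%N by rewrite !leq_mul.
have d2 : (d * d * (2 * p) <= (2 * w) * (2 * w) * (2 * (2 * w)))%N by rewrite !leq_mul.
have d3 : (d * d <= (2 * w) * (2 * w))%N by rewrite !leq_mul.
have d4 : (d * 1 * (2 * p) <= (2 * w) * 1 * (2 * (2 * w)))%N by rewrite !leq_mul.
have w12 : (w <= w * w)%N by rewrite leq_pmulr.
have w23 : (w * w <= w * w * w)%N by rewrite leq_pmulr.
rewrite !expnS expn0 !mulnA muln1 in r_bound t_bound *; nia.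
Qed.

Lemma factorize_cost n M I X (a : local_qp R n M) w :
  let F := fr (factorize I X a).1 in
  (0 < w)%N -> (#|I| <= w)%N -> (Pdim F <= 2 * w)%N -> (Rdim F <= 2 * w)%N ->
  ((factorize I X a).2 <= 130 * w ^ 3)%N.
Proof.
pose rk := gauss_rank (mxsub (enum_val (A := mem I)) (enum_val (A := mem I)) (lQ a)).
pose F := Front a I X rk.1.
have -> : fr (factorize I X a).1 = F by rewrite factorizeE.
have -> : (factorize I X a).2 =
    (rk.2 + ((gauss_solve (JPP F) 1%:M).2
        + (Rdim F * Pdim F * (2 * Pdim F) + (Rdim F * Rdim F * (2 * Pdim F)
          + (Rdim F * Rdim F + (Rdim F * 1 * (2 * Pdim F) + (Rdim F * 1 + 0)))))))%N by [].
move=> F2; rewrite {}/F2 => w_gt0 Iw Pw Rw.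
exact: (cost_arith w_gt0 Iw Pw Rw (gauss_rank_cost _) (gauss_solve_cost _ _)).
Qed.

End Costs.

(** * The recursion of the gather stage *)

Section Gather.

Variables (R : realFieldType) (n M : nat) (N : finType) (adj : rel N).
Variables (chi : N -> {set 'I_n}) (local : N -> local_qp R n M).
Implicit Types (l c : N) (p : option N) (s : step R n M).
Implicit Types (m : timed (step R n M * seq (step R n M))).

Local Notation gather := (gather adj chi local).
Local Notation children := (children adj).

Definition collect (a : local_qp R n M) (ss : seq (step R n M)) : local_qp R n M :=
  foldl (fun a s => (absorb a s).1) a ss.

Definition absorb_cost s : nat := #|xi_set (fr s)| * #|xi_set (fr s)| + #|xi_set (fr s)|.

(** The body of the recursion, abstracted from the recursive calls: invariants
    are then proved by induction on the tree, without fuel. *)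
Definition combine l p (ms : seq (timed (step R n M * seq (step R n M)))) :
    timed (step R n M * seq (step R n M)) :=
  let f := factorize (chi l :\: parent_bag chi p) (chi l :&: parent_bag chi p)
             (collect (local l) [seq m.1.1 | m <- ms]) in
  ((f.1, flatten [seq rcons m.1.2 m.1.1 | m <- ms]),
   (\sum_(m <- ms) (m.2 + absorb_cost m.1.1) + f.2)%N).

Lemma gatherS fuel l p :
  gather fuel.+1 l p = combine l p [seq gather fuel c (Some l) | c <- children l p].
Proof.
rewrite [LHS]/=; set st := foldl _ _ _.
suff -> : st =
  ((collect (local l) [seq m.1.1 | m <- [seq gather fuel c (Some l) | c <- children l p]],
    flatten [seq rcons m.1.2 m.1.1 | m <- [seq gather fuel c (Some l) | c <- children l p]]),
   \sum_(m <- [seq gather fuel c (Some l) | c <- children l p]) (m.2 + absorb_cost m.1.1))%N.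
  by rewrite /combine /bind /= addn0.
have gen (cs : seq N) (a : local_qp R n M) L k : foldl
  (fun (st : timed (local_qp R n M * seq (step R n M))) c =>
     let! s := st in
     let! m := gather fuel c (Some l) in
     let! a' := absorb s.1 m.1 in
     ret (a', s.2 ++ rcons m.2 m.1)) ((a, L), k) cs
  = ((collect a [seq m.1.1 | m <- [seq gather fuel c (Some l) | c <- cs]],
   L ++ flatten [seq rcons m.1.2 m.1.1 | m <- [seq gather fuel c (Some l) | c <- cs]]),
   (k + \sum_(m <- [seq gather fuel c (Some l) | c <- cs]) (m.2 + absorb_cost m.1.1))%N).
  elim: cs a L k => [|c cs IH] a L k; first by rewrite /= big_nil addn0 cats0.
  rewrite [LHS]/= {1}/bind /= IH big_cons /= catA addn0 !addnA.
  by [].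
by rewrite /st gen.
Qed.

Hypothesis tree : is_tree adj.

(** Each call treats one branch of the tree, and the branches shrink along the
    recursion, so fuel never runs out. *)
Lemma gather_ind (Inv : N -> option N -> timed (step R n M * seq (step R n M)) -> Prop) :
  (forall l p (ms : N -> timed (step R n M * seq (step R n M))), rooted_at adj l p ->
     (forall c, c \in children l p -> Inv c (Some l) (ms c)) ->
     Inv l p (combine l p [seq ms c | c <- children l p])) ->
  forall root, Inv root None (gather #|N| root None).
Proof.
move=> step_Inv root.
have: (#|branch adj root None| <= #|N|)%N by apply: max_card.
have: rooted_at adj root None by [].
elim: #|N| root None => [|fuel IH] l p lp.
  by rewrite leqn0 cards_eq0 => /eqP b0; have := branch_refl adj l p; rewrite b0 inE.
move=> le_fuel; rewrite gatherS; apply: step_Inv => // c c_in.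
apply: IH; first by apply: rooted_child c_in.
rewrite -ltnS (leq_trans _ le_fuel) // proper_card // properE sub_branch //=.
apply/subsetPn; exists l; first exact: branch_refl.
exact: notin_branch_child c_in.
Qed.

Lemma combine_front l p ms cs :
  exists r, fr (combine l p [seq ms c | c <- cs]).1.1
    = Front (collect (local l) [seq (ms c).1.1 | c <- cs])
        (chi l :\: parent_bag chi p) (chi l :&: parent_bag chi p) r.
Proof.
have [r] := factorize_front (chi l :\: parent_bag chi p) (chi l :&: parent_bag chi p)
  (collect (local l) [seq m.1.1 | m <- [seq ms c | c <- cs]]).
rewrite /combine; move: (factorize _ _ _) => f; rewrite -map_comp => fE; exists r; exact: fE.
Qed.

Lemma all_combine (P : pred (step R n M)) l p ms cs :
  all P (combine l p [seq ms c | c <- cs]).1.2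
    = all (fun c => all P ((ms c).1.1 :: (ms c).1.2)) cs.
Proof.
rewrite /combine /=; elim: cs => //= c cs <-.
by rewrite all_cat all_rcons.
Qed.

Lemma collect_vres z a ss :
  vres (collect a ss) z = vres a z + \sum_(s <- ss) vres (message s) z.
Proof.
elim: ss a => [|s ss IH] a /=; first by rewrite big_nil addr0.
rewrite IH big_cons addrA; congr (_ + _); rewrite /vres /= big_cat /= mulmxDl.
by rewrite opprD (addrACA (lQ a *m z.1)) [LHS]addrACA.
Qed.

Lemma collect_rows a ss :
  lrows (collect a ss) = lrows a ++ flatten [seq lrows (message s) | s <- ss].
Proof.
elim: ss a => [|s ss IH] a /=; first by rewrite cats0.
by rewrite IH /= catA.
Qed.

Lemma on_bag_sub (X Y : {set 'I_n}) (a : local_qp R n M) :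
  X \subset Y -> on_bag X a -> on_bag Y a.
Proof.
move=> XY [symQ QX bX GX]; have YX : proj R Y *m proj R X = proj R X.
  by rewrite proj_mul (setIidPr XY).
have XYp : proj R X *m proj R Y = proj R X by rewrite proj_mul (setIidPl XY).
split=> //; first by rewrite -QX mulmxA YX.
  by rewrite -bX mulmxA YX.
by apply: sub_all GX => r /eqP rX; rewrite -rX -mulmxA XYp.
Qed.

Lemma collect_bag (X : {set 'I_n}) a (f : N -> step R n M) cs : on_bag X a ->
  {in cs, forall c, on_bag X (message (f c))} -> on_bag X (collect a (map f cs)).
Proof.
elim: cs a => //= c cs IH a aX mX; apply: IH => [|c' c'_in]; last first.
  by apply: mX; rewrite inE c'_in orbT.
have [symQ QX bX GX] := aX; have [symQ' QX' bX' GX'] := mX c (mem_head _ _).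
split; rewrite /= ?mulmxDr; first by rewrite raddfD /= symQ symQ'.
- by rewrite QX QX'.
- by rewrite bX bX'.
by rewrite /rows_on all_cat; apply/andP; split.
Qed.

(** ** The messages represent the branches *)

Hypothesis local_bag : forall l, on_bag (chi l) (local l).

Definition fits l p s : Prop :=
  iota_set (fr s) = chi l :\: parent_bag chi p /\ xi_set (fr s) = chi l :&: parent_bag chi p.

(** The step [m.1.1] is that of [l], and [m.1.2] lists those below it. The
    condition on the messages leaves out that of [l] itself, which for the root
    is never sent. *)
Definition represents l p m : Prop :=
  all (fun s => JPP (fr s) \in unitmx) (m.1.1 :: m.1.2) ->
  all (fun s => drsubmx (msgJ s) == 0) m.1.2 ->
  [/\ factorized m.1.1, fits l p m.1.1, wf_front (fr m.1.1) &
    forall z, all (fun s => solves z (fr s)) (m.1.1 :: m.1.2) ->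
      vres (acc (fr m.1.1)) z = \sum_(j in branch adj l p) vres (local j) z
      /\ (all (sat z) (lrows (acc (fr m.1.1))) ->
          {in branch adj l p, forall j, all (sat z) (lrows (local j))})].

Lemma combine_represents l p ms : rooted_at adj l p ->
  (forall c, c \in children l p -> represents c (Some l) (ms c)) ->
  represents l p (combine l p [seq ms c | c <- children l p]).
Proof.
move=> lp IH.
rewrite /represents all_consE !all_combine => /andP[uP /allP unitJ] /allP dr0.
have {}dr0 c : c \in children l p -> drsubmx (msgJ (ms c).1.1) = 0
    /\ all (fun s => drsubmx (msgJ s) == 0) (ms c).1.2.
  by move=> /dr0 /= /andP[/eqP].
have {}IH c (c_in : c \in children l p) := IH c c_in (unitJ c c_in) (dr0 c c_in).2.
have fs := factorizeP uP; set s := (combine _ _ _).1.1 in uP fs *.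
have [r sE] := combine_front l p ms (children l p); rewrite -/s in sE.
have accE : acc (fr s) = collect (local l) [seq (ms c).1.1 | c <- children l p].
  by rewrite sE.
have fit : fits l p s by split; rewrite sE.
have wf : wf_front (fr s).
  have bagE : front_bag (fr s) = chi l by rewrite /front_bag sE /= setUC setID.
  split.
    rewrite sE /= -setI_eq0; apply/eqP/setP => u; rewrite !inE.
    by case: (u \in parent_bag _ _); rewrite ?andbF.
  rewrite bagE accE; apply: collect_bag => // c c_in.
  have [fc [_ xiE] wfc _] := IH c c_in.
  by apply: on_bag_sub (message_bag fc wfc); rewrite xiE subsetIr.
split=> // z; rewrite all_consE all_combine => /andP[_ /allP sol_z].
have sol_c c (c_in : c \in children l p) : solves z (fr (ms c).1.1) by case/andP: (sol_z c c_in).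
rewrite accE; split.
  rewrite collect_vres big_branch // big_map; congr (_ + _).
  rewrite !big_seq; apply: eq_bigr => c c_in.
  have [fc _ wfc /(_ z (sol_z c c_in))[<- _]] := IH c c_in.
  exact: message_vres (sol_c c c_in).
rewrite collect_rows all_cat => /andP[sat_l sat_msgs] j /(branchP tree _ lp)[->//|[c c_in j_in]].
have [fc _ wfc /(_ z (sol_z c c_in))[_ sat_c]] := IH c c_in.
apply: sat_c j_in; apply: message_sat (sol_c c c_in) (dr0 c c_in).1 _ => //.
move: sat_msgs; rewrite -map_comp; elim: (children l p) c_in => //= c' cs IHcs.
by rewrite inE all_cat => /predU1P[<-|/IHcs sat_cs] /andP[].
Qed.

Lemma gather_represents root : represents root None (gather #|N| root None).
Proof. by move: root; refine (@gather_ind represents _); apply: combine_represents. Qed.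

(** ** The order of elimination *)

Hypothesis chi_tree : forall u, tree_on adj [set j | u \in chi j].
Hypothesis labels_uniq : forall l, uniq (labels (lrows (local l))).
Hypothesis labels_owner : forall i j k,
  k \in labels (lrows (local i)) -> k \in labels (lrows (local j)) -> i = j.

Definition node_vars l (v : 'I_n + 'I_M) : bool :=
  match v with inl u => u \in chi l | inr k => k \in labels (lrows (local l)) end.

Definition confined l p : pred ('I_n + 'I_M) :=
  fun v => [forall j, node_vars j v ==> (j \in branch adj l p)].

Definition touched l p : pred ('I_n + 'I_M) :=
  fun v => [exists j in branch adj l p, node_vars j v].

(** The steps are listed descendants first, the reverse of the order of
    back-substitution. The rest of the last step is what is handed on to the
    parent; that no pivot of the branch occurs in it carries the induction. *)
Definition scheduled l p m : Prop :=
  let ss := rcons m.1.2 m.1.1 in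
  [/\ fits l p m.1.1,
      all (fun s => [forall v, pivots s v ==> confined l p v]) ss,
      all (fun s => [forall v, (pivots s v || rest s v) ==> touched l p v]) ss,
      all (fun s => uniq (labels (lrows (acc (fr s)))) && separated (pivots s) (rest s)) ss
        && all (fun s => separated (pivots s) (rest m.1.1)) ss &
      pairwise (@decoupled R n M) ss].

Lemma confined_touched l p l' p' v : confined l p v -> touched l' p' v ->
  exists2 j, j \in branch adj l p & j \in branch adj l' p'.
Proof.
by move=> /forallP own /existsP[j /andP[j_in vj]]; exists j => //; apply: (implyP (own j)).
Qed.

(** Pivots below a child [c] are confined to the branch of [c]. Hence they occur
    neither at [l] nor in the branch of another child, and they reach the front
    of [l] only through the message of [c], which has none of them. *)
Lemma gather_scheduled root : scheduled root None (gather #|N| root None).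
Proof.
move: root; refine (@gather_ind scheduled _) => l p ms lp IH.
have [r sE] := combine_front l p ms (children l p).
have LE : (combine l p [seq ms c | c <- children l p]).1.2
    = flatten [seq rcons (ms c).1.2 (ms c).1.1 | c <- children l p].
  by rewrite /combine /= -map_comp.
rewrite /scheduled LE; set s := (combine _ _ _).1.1 in sE *; clearbody s.
have all_below (P : pred (step R n M)) :
    {in children l p, forall c, all P (rcons (ms c).1.2 (ms c).1.1)} ->
    all P (flatten [seq rcons (ms c).1.2 (ms c).1.1 | c <- children l p]).
  elim: (children l p) => //= c cs IHcs Pc; rewrite all_cat Pc ?mem_head //= IHcs //.
  by move=> c' c'_in; apply: Pc; rewrite inE c'_in orbT.
have all_branch (P : pred (step R n M)) : P s ->
    {in children l p, forall c, all P (rcons (ms c).1.2 (ms c).1.1)} ->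
    all P (rcons (flatten [seq rcons (ms c).1.2 (ms c).1.1 | c <- children l p]) s).
  by move=> Ps Pc; rewrite all_rcons Ps all_below.
have own_l c v : c \in children l p -> confined c (Some l) v -> node_vars l v -> False.
  move=> c_in /forallP/(_ l)/implyP own /own l_in.
  by have := notin_branch_child tree c_in; rewrite l_in.
have own_c c c' v : c \in children l p -> c' \in children l p ->
    confined c (Some l) v -> touched c' (Some l) v -> c = c'.
  move=> c_in c'_in own tou; have [j jc jc'] := confined_touched own tou.
  exact: (disjoint_branches tree c_in c'_in jc jc').
have rest_touched c v : c \in children l p -> rest (ms c).1.1 v -> touched c (Some l) v.
  move=> c_in rv; have [_ _ + _ _] := IH c c_in.
  by rewrite all_rcons => /andP[/forallP/(_ v)/implyP + _]; apply; rewrite rv orbT.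
have labE : labels (lrows (acc (fr s))) = labels (lrows (local l))
    ++ flatten [seq labels (kept_rows (fr (ms c).1.1)) | c <- children l p].
  rewrite sE /= collect_rows /labels map_cat map_flatten -!map_comp; congr (_ ++ flatten _).
  by apply: eq_map => c /=; rewrite message_labels.
have scopeE v : pivots s v || rest s v ->
    node_vars l v \/ exists2 c, c \in children l p & rest (ms c).1.1 v.
  case: v => [u|k] /=.
    by rewrite !sE /= !inE => uv; left; move: uv; case: (u \in chi l); rewrite ?andbF.
  rewrite -mem_cat -labels_front labE mem_cat.
  case/orP=> [|/flattenP[ks /mapP[c c_in ->] kc]]; first by left.
  by right; exists c.
have scope_touched v : pivots s v || rest s v -> touched l p v.
  case/scopeE => [lv|[c c_in /(rest_touched _ _ c_in)/existsP[j /andP[jc jv]]]].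
    by apply/existsP; exists l; rewrite branch_refl.
  by apply/existsP; exists j; rewrite jv andbT (subsetP (sub_branch tree lp c_in)).
have sep_s c : c \in children l p ->
    all (fun s' => separated (pivots s') (predU (pivots s) (rest s))) (rcons (ms c).1.2 (ms c).1.1).
  move=> c_in; have [_ own _ /andP[_ sep] _] := IH c c_in.
  have := conj own sep => /andP; rewrite -all_predI; apply: sub_all.
  move=> s' /andP[/forallP own_s' /separatedP sep_s'].
  apply/separatedP => v pv /= /scopeE[lv|[c' c'_in rv]].
    exact: (own_l c v c_in (implyP (own_s' v) pv) lv).
  have cc' := own_c c c' v c_in c'_in (implyP (own_s' v) pv) (rest_touched c' v c'_in rv).
  by rewrite -cc' in rv; apply: (sep_s' v).
have uniq_s : uniq (labels (lrows (acc (fr s)))).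
  rewrite labE cat_uniq labels_uniq /=; apply/andP; split.
    apply/hasPn => k /flattenP[ks /mapP[c c_in ->] kc]; apply/negP => /= kl.
    have /existsP[j /andP[jc jk]] := rest_touched c (inr k) c_in kc.
    rewrite -(labels_owner kl jk) in jc.
    by have := notin_branch_child tree c_in; rewrite jc.
  rewrite uniq_pairwise; apply: pairwise_flatten; first exact: uniq_children.
    move=> c c_in; rewrite -uniq_pairwise; have [_ _ _ + _] := IH c c_in.
    by rewrite all_rcons labels_front cat_uniq => /andP[/andP[/andP[/and3P[]]]].
  move=> c1 c2 c1_in c2_in c12; apply/allrelP => k1 k2 k1c k2c; apply: contraNneq c12 => k12.
  rewrite -k12 in k2c.
  have /existsP[i /andP[ic ik]] := rest_touched c1 (inr k1) c1_in k1c.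
  have /existsP[j /andP[jc jk]] := rest_touched c2 (inr k1) c2_in k2c.
  have ij := labels_owner ik jk; rewrite -ij in jc.
  by apply/eqP; apply: (disjoint_branches tree c1_in c2_in ic jc).
split; first by rewrite /fits sE.
- apply: all_branch => [|c c_in].
    apply/forallP => -[u|k]; apply/implyP => pv; apply/forallP => j; apply/implyP => /= jv.
      (* The bags containing u form a subtree through l; since u is not in the
         parent's bag, that subtree stays in the branch. *)
      move: pv; rewrite /= sE /= inE => /andP[u_p u_l].
      have [_ /(_ l j) + _] := chi_tree u; rewrite !inE => /(_ u_l jv).
      apply: connect_sub => x y /= /and3P[]; rewrite !inE => ux uy xy; apply: connect1.
      rewrite /avoid /= xy andbT; case: (p) u_p => //= p' u_p'.
      by apply/andP; split; apply: contraNneq u_p' => -[<-].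
    have /existsP[i /andP[i_in ik]] : touched l p (inr k) by apply: scope_touched; rewrite pv.
    by rewrite -(labels_owner ik jv).
  have [_ + _ _ _] := IH c c_in; apply: sub_all => s' /forallP own; apply/forallP => v.
  apply/implyP => /(implyP (own v)) /forallP own_v; apply/forallP => j.
  apply/implyP => /(implyP (own_v j)); exact: (subsetP (sub_branch tree lp c_in)).
- apply: all_branch => [|c c_in]; first by apply/forallP => v; apply/implyP; apply: scope_touched.
  have [_ _ + _ _] := IH c c_in; apply: sub_all => s' /forallP tou; apply/forallP => v.
  apply/implyP => /(implyP (tou v)) /existsP[j /andP[jc jv]]; apply/existsP; exists j.
  by rewrite jv andbT (subsetP (sub_branch tree lp c_in)).
- have sep_ss : separated (pivots s) (rest s).
    apply/separatedP => -[u|k] /=.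
      by rewrite sE /= !inE; case: (u \in parent_bag _ _); rewrite ?andbF.
    move: uniq_s; rewrite labels_front cat_uniq => /and3P[_ /hasPn/(_ k) notin _] ke.
    by move/notin; rewrite ke.
  apply/andP; split.
    by apply: all_branch => [|c c_in]; [rewrite uniq_s | have [_ _ _ /andP[]] := IH c c_in].
  apply: all_branch => // c c_in.
  apply: sub_all (sep_s c c_in) => s' /separatedP sep; apply/separatedP => v pv rv.
  by apply: (sep v pv); rewrite /= rv orbT.
rewrite pairwise_rcons all_below //=.
apply: pairwise_flatten; first exact: uniq_children.
  by move=> c c_in; have [] := IH c c_in.
move=> c1 c2 c1_in c2_in c12; have [_ own _ _ _] := IH c1 c1_in; have [_ _ tou _ _] := IH c2 c2_in.
apply: allrel_all own tou _ => s1 s2 /forallP own1 /forallP tou2; apply/separatedP => v pv /= sv.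
move: c12; rewrite (own_c c1 c2 v) ?eqxx //; first exact: (implyP (own1 v)).
exact: (implyP (tou2 v)).
Qed.

(** ** The computed point solves all equations *)

Lemma gather_pivot_inv root : let m := gather #|N| root None in
  all (fun s => (JPP (fr s) \in unitmx) ==> (pivot_inv s == invmx (JPP (fr s)))) (m.1.1 :: m.1.2).
Proof.
pose P s := (JPP (fr s) \in unitmx) ==> (pivot_inv s == invmx (JPP (fr s))).
move: root; refine (@gather_ind (fun _ _ m => all P (m.1.1 :: m.1.2)) _) => l p ms lp IH.
rewrite all_consE all_combine; apply/andP; split; last by apply/allP.
by apply/implyP => /factorizeP[_ -> _ _].
Qed.

Definition back_cost s : nat :=
  Pdim (fr s) * 1 * (2 * Rdim (fr s)) + Pdim (fr s) * 1 + Pdim (fr s) * 1 * (2 * Pdim (fr s)).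

Lemma message_passingE root : message_passing adj chi local root =
  let m := gather #|N| root None in
  let zR := gauss_solve (msgJ m.1.1) (msgg m.1.1) in
  (back (write_R zR.1 (0, 0)) (m.1.1 :: rev m.1.2),
   (m.2 + (zR.2 + \sum_(s <- m.1.1 :: rev m.1.2) back_cost s))%N).
Proof.
rewrite /message_passing; move: (gather _ _ _) => [[s L] k].
have fold_back ss z t :
    foldl (fun st s => let! z := st in back_substitute z s) (z, t) ss
    = (back z ss, (t + \sum_(s <- ss) back_cost s)%N).
  elim: ss z t => [|s' ss IH] z t; first by rewrite big_nil addn0.
  by rewrite big_cons addnA -IH /back_cost /= /bind /= !addnA addn0.
by rewrite /bind fold_back add0n.
Qed.

Lemma message_passing_solves root : well_posed_run adj chi local root ->
  let z := (message_passing adj chi local root).1 in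
  \sum_j vres (local j) z = 0 /\ forall j, all (sat z) (lrows (local j)).
Proof.
have inv := gather_pivot_inv root; have sch := gather_scheduled root.
have rep := @gather_represents root; rewrite message_passingE /well_posed_run.
set m := gather _ _ _ in inv sch rep *; case: m => [[s L] k] in inv sch rep *.
move=> /and3P[unitP unit_root dr0].
pose z := back (write_R (gauss_solve (msgJ s) (msgg s)).1 (0, 0)) (s :: rev L).
change (\sum_j vres (local j) z = 0 /\ forall j, all (sat z) (lrows (local j))).
have [fs fits_s wfs sol_rep] := rep unitP dr0.
have [_ _ _ /andP[uniq_sep sep_root] dec] := sch.
have solved : all (fun s => solves z (fr s)) (s :: L).
  have revE : s :: rev L = rev (rcons L s) by rewrite rev_rcons.
  suff: all (fun s => solves z (fr s)) (s :: rev L) by rewrite !all_consE all_rev.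
  apply: back_solves; rewrite revE ?all_rev ?pairwise_rev // all_rcons.
  have := conj unitP inv => /andP; rewrite -all_predI; apply: sub_all => s' /andP[/= uP].
  by rewrite /invertible uP.
have root_R : read_R (fr s) z = (gauss_solve (msgJ s) (msgg s)).1.
  rewrite -[RHS](read_write_R _ (0, 0)); last first.
    by move: uniq_sep; rewrite all_rcons labels_front cat_uniq => /andP[/andP[/and3P[]]].
  apply: eq_read_R => v rv; apply: back_out.
  have: all (fun s' => ~~ pivots s' v) (rcons L s); last by rewrite all_rcons all_consE all_rev.
  by apply: sub_all sep_root => s' /separatedP sep; apply/negP => /sep/(_ rv).
have sol_s : solves z (fr s) by case/andP: solved.
have [sumE all_satE] := sol_rep z solved; split; last first.
  move=> j; apply: all_satE; last by rewrite branch_root ?in_setT.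
  apply: root_sat => //; rewrite root_R gauss_solveE ?mulKVmx //; exact: Jmx_msgJ.
have -> : \sum_j vres (local j) z = vres (acc (fr s)) z.
  by rewrite sumE branch_root //; apply: eq_bigl => j; rewrite in_setT.
rewrite -(message_vres fs wfs sol_s) -(vres_on_bag z (message_bag fs wfs)).
by have [_ ->] := fits_s; rewrite setI0 proj_set0 mul0mx.
Qed.

(** ** The cost of the gather stage *)

Variable w : nat.
Hypothesis chi_w : forall l, (#|chi l| <= w)%N.
Hypothesis w_gt0 : (0 < w)%N.

Definition small s : bool := (Pdim (fr s) <= 2 * w)%N && (Rdim (fr s) <= 2 * w)%N.

(** Receiving a message is charged to its sender, so that costs add up over the
    branch. Independence of the rows is a premise because it comes from the
    parent, against the direction of the recursion. *)
Definition cheap l p m : Prop :=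
  represents l p m /\
  (all (fun s => JPP (fr s) \in unitmx) (m.1.1 :: m.1.2) ->
   all (fun s => drsubmx (msgJ s) == 0) m.1.2 ->
   indep (lrows (acc (fr m.1.1))) ->
   all small (m.1.1 :: m.1.2)
   /\ (m.2 + absorb_cost m.1.1 <= 132 * w ^ 3 * #|branch adj l p|)%N).

Lemma gather_size root : let m := gather #|N| root None in
  (size m.1.2).+1 = #|N|.
Proof.
suff: (size (gather #|N| root None).1.2).+1 = #|branch adj root None|.
  by rewrite branch_root // cardsT.
move: root; refine (@gather_ind (fun l p m => (size m.1.2).+1 = #|branch adj l p|) _).
move=> l p ms lp IH.
rewrite -sum1_card big_branch //= add1n; congr _.+1.
rewrite -map_comp size_flatten /shape -map_comp sumnE big_map !big_seq.
by apply: eq_bigr => c c_in; rewrite /= size_rcons sum1_card IH.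
Qed.

Lemma gather_cheap root : cheap root None (gather #|N| root None).
Proof.
move: root; refine (@gather_ind cheap _) => l p ms lp IH.
have rep_c c : c \in children l p -> represents c (Some l) (ms c) by move=> /IH[].
have rep := combine_represents lp rep_c; split=> // unitP dr0 ind.
have [fs [iotaE xiE] [_ [_ _ _ on_s]] _] := rep unitP dr0.
have [r sE] := combine_front l p ms (children l p).
set s := (combine _ _ _).1.1 in unitP ind fs iotaE xiE on_s sE *.
have bagE : front_bag (fr s) = chi l by rewrite /front_bag iotaE xiE setUC setID.
have rows_w : (size (lrows (acc (fr s))) <= w)%N.
  by apply: leq_trans (chi_w l); rewrite -bagE; apply: indep_size.
have iota_w : (#|iota_set (fr s)| <= w)%N.
  by rewrite iotaE (leq_trans _ (chi_w l)) // subset_leq_card // subsetDl.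
have xi_w : (#|xi_set (fr s)| <= w)%N.
  by rewrite xiE (leq_trans _ (chi_w l)) // subset_leq_card // subsetIl.
have small_s : small s.
  rewrite /small /Pdim /Rdim mul2n -addnn !leq_add //; apply: leq_trans rows_w.
    by rewrite size_drop leq_subr.
  by rewrite size_take_min geq_minr.
have below c : c \in children l p -> all small ((ms c).1.1 :: (ms c).1.2)
    /\ ((ms c).2 + absorb_cost (ms c).1.1 <= 132 * w ^ 3 * #|branch adj c (Some l)|)%N.
  move=> c_in; move: unitP dr0; rewrite all_consE !all_combine.
  move=> /andP[_ /allP/(_ c c_in) unit_c] /allP/(_ c c_in)/andP[_ dr0_c].
  have [rc cheap_c] := IH c c_in; apply: cheap_c => //.
  have [fc _ _ _] := rc unit_c dr0_c; apply: message_indep => //.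
  move: ind; rewrite sE /= collect_rows -map_comp => /indep_catr.
  elim: (children l p) c_in => //= c' cs IHcs; rewrite inE => /predU1P[<-|c_in].
    exact: indep_catl.
  by move=> /indep_catr; apply: IHcs.
split.
  rewrite all_consE small_s all_combine; apply/allP => c c_in.
  by have [] := below c c_in.
have cost_s : ((combine l p [seq ms c | c <- children l p]).2 + absorb_cost s
    <= \sum_(c <- children l p) ((ms c).2 + absorb_cost (ms c).1.1)
       + 130 * w ^ 3 + absorb_cost s)%N.
  rewrite leq_add2r {1}/combine [X in (X <= _)%N]/= big_map leq_add2l; case/andP: small_s => Ps Rs.
  by apply: factorize_cost => //; rewrite -iotaE.
apply: leq_trans cost_s _.
have -> : #|branch adj l p| = (1 + \sum_(c <- children l p) #|branch adj c (Some l)|)%N.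
  by rewrite -sum1_card big_branch //; congr addn; apply: eq_bigr => c _; rewrite sum1_card.
rewrite mulnDr muln1 -addnA addnC leq_add //; last first.
  by rewrite big_distrr /= !big_seq leq_sum // => c /below[].
(* 132 is 130 for the factorization and 2 for receiving the message. *)
have absorb_w : (absorb_cost s <= w * w + w)%N by rewrite /absorb_cost leq_add // leq_mul.
have w12 : (w <= w * w)%N by rewrite leq_pmulr.
have w23 : (w * w <= w * w * w)%N by rewrite leq_pmulr.
rewrite !expnS expn0 muln1 mulnA; lia.
Qed.

Lemma message_passing_cost root : well_posed_run adj chi local root ->
  ((message_passing adj chi local root).2 <= 210 * w ^ 3 * #|N|)%N.
Proof.
have sz := gather_size root; have [rep cheap_m] := @gather_cheap root.
rewrite message_passingE /well_posed_run.
set m := gather _ _ _ in sz rep cheap_m *; case: m => [[s L] k] in sz rep cheap_m *.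
move=> /and3P[unitP unit_root dr0].
have [small_sL gather_k] := cheap_m unitP dr0 (Jmx_indep unit_root).
(* 210 is 132 for gathering, 60 for the system at the root, 18 for substitution. *)
change (k + ((gauss_solve (msgJ s) (msgg s)).2 + \sum_(s <- s :: rev L) back_cost s)
  <= 210 * w ^ 3 * #|N|)%N.
have w12 : (w <= w * w)%N by rewrite leq_pmulr.
have w23 : (w * w <= w * w * w)%N by rewrite leq_pmulr.
have gather_cost : (k <= 132 * w ^ 3 * #|N|)%N.
  have <- : #|branch adj root None| = #|N| by rewrite branch_root // cardsT.
  exact: leq_trans (leq_addr _ _) gather_k.
have back_w s' : small s' -> (back_cost s' <= 18 * w ^ 3)%N.
  rewrite /small /back_cost !expnS expn0 muln1 => /andP[].
  move: (Pdim _) (Rdim _) => p d p_w d_w.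
  have pd : (p * d <= (2 * w) * (2 * w))%N by rewrite leq_mul.
  have pp : (p * p <= (2 * w) * (2 * w))%N by rewrite leq_mul.
  by rewrite !muln1; nia.
have root_w : ((gauss_solve (msgJ s) (msgg s)).2 <= 60 * w ^ 3)%N.
  apply: leq_trans (gauss_solve_cost _ _) _; have /andP[/andP[_ Rw] _] := small_sL.
  have: (5 * Rdim (fr s) * Rdim (fr s) * (Rdim (fr s) + 1)
         <= 5 * (2 * w) * (2 * w) * (2 * w + w))%N.
    by rewrite !leq_mul // leq_add.
  by rewrite !expnS expn0; lia.
have back_all : (\sum_(s <- s :: rev L) back_cost s <= 18 * w ^ 3 * #|N|)%N.
  have small_all : all small (s :: rev L) by move: small_sL; rewrite !all_consE all_rev.
  have <- : size (s :: rev L) = #|N| by rewrite /= size_rev -sz.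
  elim: (s :: rev L) small_all => [|s' L' IH]; first by rewrite big_nil.
  move=> /andP[/back_w s'_w /IH L'_w]; rewrite big_cons /= mulnS leq_add //.
have N_gt0 : (0 < #|N|)%N by rewrite -sz.
have : (60 * w ^ 3 <= 60 * w ^ 3 * #|N|)%N by rewrite leq_pmulr.
lia.
Qed.

End Gather.

(** * The KKT system of the quadratic program *)

Section KKTSystem.

Variables (R : realFieldType) (n q : nat) (edge : 'I_q -> {set 'I_n}).
Variable D : qp_data R edge.

Lemma edge_qp_bag e : (Qe D e)^T = Qe D e -> on_bag (edge e) (edge_qp D e).
Proof.
move=> symQ; split=> /=.
- by rewrite /padQ !trmx_mul trmxK symQ mulmxA.
- by rewrite !mulmxA -[proj _ _]proj_tr -trmx_mul sel_proj.
- by rewrite !mulmxA -[proj _ _]proj_tr -trmx_mul sel_proj.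
by rewrite /rows_on all_map; apply/allP => k _ /=; rewrite -row_mul -mulmxA sel_proj.
Qed.

Lemma edge_qp_labels e :
  labels (lrows (edge_qp D e)) = [seq tagnat.Rank e k | k <- enum 'I_(nrows D e)].
Proof. by rewrite /labels -map_comp. Qed.

Lemma edge_qp_labels_uniq e : uniq (labels (lrows (edge_qp D e))).
Proof.
rewrite edge_qp_labels map_inj_uniq ?enum_uniq // => i j ij.
by have /eqP := can_inj tagnat.rankK ij; rewrite eq_Tagged => /eqP.
Qed.

Lemma edge_qp_labels_owner e1 e2 k : k \in labels (lrows (edge_qp D e1)) ->
  k \in labels (lrows (edge_qp D e2)) -> e1 = e2.
Proof.
rewrite !edge_qp_labels => /mapP[i _ ->] /mapP[j _ /(congr1 tagnat.sig1)].
by rewrite !tagnat.Rank1K.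
Qed.

Lemma edge_qp_vres e z : vres (edge_qp D e) z
  = padQ D e *m z.1 + (padG D e)^T *m submxcol z.2 e - padb D e.
Proof.
rewrite /vres /= big_map big_enum /=; congr (_ + _ - _).
apply/colP => u; rewrite summxE mxE; apply: eq_bigr => k _.
by rewrite !mxE mulrC.
Qed.

Lemma edge_qp_sat e z : all (sat z) (lrows (edge_qp D e)) -> padG D e *m z.1 = he D e.
Proof.
rewrite /= all_map => /allP sat_e; apply/colP => k.
by have /eqP /= <- := sat_e k (mem_enum _ _); rewrite -row_mul [RHS]mxE.
Qed.

Lemma KKT_residuals (z : 'cV[R]_n * 'cV[R]_(total_rows D)) :
  \sum_e vres (edge_qp D e) z = 0 -> (forall e, all (sat z) (lrows (edge_qp D e))) ->
  KKTmx D *m col_mx z.1 z.2 = col_mx (bvec D) (hvec D).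
Proof.
move=> vres0 sat_z; rewrite mul_block_col mul0mx addr0; congr col_mx.
  apply/eqP; rewrite -subr_eq0 -vres0; apply/eqP.
  under eq_bigr => e _ do rewrite edge_qp_vres.
  rewrite !big_split /= sumrN /Qmx mulmx_suml /Gmx tr_mxcol -{1}[z.2]submxcolK.
  by rewrite mul_mxrow_mxcol.
by rewrite /Gmx mxcol_mul; apply/mxcolP => e; rewrite !mxcolK edge_qp_sat.
Qed.

End KKTSystem.

Theorem theorem2 :
  exists C : nat,
  forall (R : realFieldType) (n q : nat) (edge : 'I_q -> {set 'I_n})
    (D : qp_data R edge)
    (N : finType) (adj : rel N) (chi : N -> {set 'I_n}) (node_edge : N -> 'I_q)
    (root : N) (tw : nat),
  hypertree edge adj chi node_edge ->
  is_treewidth edge tw ->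
  width chi = tw ->
  (forall e, (Qe D e)^T = Qe D e) ->
  has_bounded_solution D ->
  full_rank_constraints D ->
  graphical_qp_well_posed D adj chi node_edge root ->
  let: (x, lambda, time) := graphical_qp D adj chi node_edge root in
  KKTmx D *m col_mx x lambda = col_mx (bvec D) (hvec D) /\
  (time <= C * (n + q) * maxn 1 tw ^ 3)%N.
Proof.
(* 1680 is 210 times 2 ^ 3, as a bag has at most tw + 1 <= 2 * maxn 1 tw vertices. *)
exists 1680%N => R n q edge D N adj chi node_edge root tw.
case=> [[tree _ _ chi_tree] bij_edge edgeE] _ widthE symQ _ _ posed.
pose w := (2 * maxn 1 tw)%N; pose local l := edge_qp D (node_edge l).
have chi_w l : (#|chi l| <= w)%N.
  have: (#|chi l| <= \max_i #|chi i|)%N by apply: leq_bigmax.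
  by rewrite /w -widthE /width; lia.
have w_gt0 : (0 < w)%N by rewrite /w; lia.
have local_bag l : on_bag (chi l) (local l) by rewrite -edgeE; apply: edge_qp_bag.
have cardN : #|N| = q by rewrite (bij_eq_card bij_edge) card_ord.
have [vres0 sat_z] := message_passing_solves tree local_bag chi_tree
  (fun l => edge_qp_labels_uniq D (node_edge l))
  (fun i j k ki kj => bij_inj bij_edge (edge_qp_labels_owner ki kj)) posed.
have cost := message_passing_cost tree local_bag chi_w w_gt0 posed.
rewrite /graphical_qp -/local in vres0 sat_z cost *.
case: (message_passing _ _ _ _) => [[x lambda] time] in vres0 sat_z cost *.
split.
  apply: (KKT_residuals (z := (x, lambda))) => [|e].
    by rewrite -[RHS]vres0 [LHS](reindex node_edge) //; apply: onW_bij.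
  by have [node _ nodeK] := bij_edge; rewrite -(nodeK e); apply: sat_z.
apply: leq_trans cost _; rewrite cardN /w expnMn.
have: (q * maxn 1 tw ^ 3 <= (n + q) * maxn 1 tw ^ 3)%N by rewrite leq_mul2r leq_addl orbT.
lia.
Qed.
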